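(* The system $\textsf{M}$ proves that the definition of open set relative to `st' is equivalent to the nonstandard version, i.e. for every set of reals $U\subseteq\mathbb{R}$ (given by a type $2$ object), we have \begin{align*} &(\forall^{\mathrm{st}}x^1\in U)(\exists^{\mathrm{st}}r^1\gg0)(\forall^{\mathrm{st}}y^1)(|x-y|\ll r\to y\in U)\\ &\qquad\leftrightarrow(\forall^{\mathrm{st}}x^1\in U)(\forall y^1)(x\approx y\to y\in U). \end{align*}
   Context: A real number is a sequence $q_{(\cdot)}^{1}$ of (coded) rationals with $(\forall n,i)(|q_n-q_{n+i}|<2^{-n})$; every $f^1$ may be viewed as a real via Kohlenbach's ``hat'' function. For reals $x=q_{(\cdot)}$, $y=r_{(\cdot)}$: $x=_{\mathbb{R}}y$ is $(\forall n)(|q_n-r_n|\le2^{-n+1})$, $x\approx y$ is $(\forall^{\mathrm{st}}n)(|q_n-r_n|\le2^{-n+1})$, $x\gg y$ (equivalently $y\ll x$) is $x>y\wedge x\not\approx y$. A set of reals $U\subseteq\mathbb{R}$ is given by a functional $f_U^2:\mathbb{R}\to\mathbb{N}$ with $x=_{\mathbb{R}}y\to f_U(x)=f_U(y)$; `$x\in U$' means $f_U(x)=1$. Type $0$ is the type of natural numbers, $1$ is $0\to0$, $2$ is $1\to0$; superscripts denote types. $\textsf{E-PA}^{\omega}$ is classical Peano arithmetic in all finite types with the axiom of extensionality. Strong majorizability $\le^*$: $x\le^*_0y$ is $x\le_0y$, and $x\le^*_{\rho\to\sigma}y$ is $(\forall v)(\forall u\le^*_\rho v)(xu\le^*_\sigma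 yv\wedge yu\le^*_\sigma yv)$. An object $x$ is monotone if $x\le^*x$; $\tilde\forall,\tilde\exists$ denote quantifiers over monotone objects. The language of $\textsf{E-PA}^{\omega}_{\mathrm{st}}$ adds a predicate $\mathrm{st}^\sigma$ (``is standard'') for each finite type $\sigma$. A formula is internal if it does not involve $\mathrm{st}$. $(\forall^{\mathrm{st}}x)\Phi$ is $(\forall x)(\mathrm{st}(x)\to\Phi)$ and $(\exists^{\mathrm{st}}x)\Phi$ is $(\exists x)(\mathrm{st}(x)\wedge\Phi)$. $\textsf{E-PA}^{\omega}_{\mathrm{st}}$ is $\textsf{E-PA}^{\omega}$ plus: (1) $x=_\sigma y\to(\mathrm{st}(x)\to\mathrm{st}(y))$; (2) $\mathrm{st}(y)\to(x\le^*_\sigma y\to\mathrm{st}(x))$; (3) $\mathrm{st}(t)$ for each closed term $t$; (4) $\mathrm{st}(z^{\sigma\to\tau})\to(\mathrm{st}(x^\sigma)\to\mathrm{st}(zx))$; and external induction $\Phi(0)\wedge(\forall^{\mathrm{st}}n^0)(\Phi(n)\to\Phi(n+1))\to(\forall^{\mathrm{st}}n^0)\Phi(n)$ for any $\Phi$. $\textsf{M}$ is $\textsf{E-PA}^{\omega}_{\mathrm{st}}$ plus, for internal $\varphi$: monotone choice $\textsf{mAC}^\omega_{\mathrm{st}}$: $(\tilde\forall^{\mathrm{st}}x)(\tilde\exists^{\mathrm{st}}y)\varphi(x,y)\to(\tilde\exists^{\mathrm{st}}f)(\tilde\forall^{\mathrm{st}}x)(\exists y\le^*f(x))\varphi(x,y)$;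 realization $\textsf{R}^\omega$: $(\forall x)(\exists^{\mathrm{st}}y)\varphi(x,y)\to(\tilde\exists^{\mathrm{st}}z)(\forall x)(\exists y\le^*z)\varphi(x,y)$; and $\textsf{MAJ}^\omega_{\mathrm{st}}$: $(\forall^{\mathrm{st}}x)(\exists^{\mathrm{st}}y)(x\le^*y)$. *)

(* Defs.v *)
From Stdlib Require Import List.
Import ListNotations.

Set Implicit Arguments.
Unset Strict Implicit.
Unset Printing Implicit Defensive.
Set Contextual Implicit.

Declare Scope ty_scope.
Declare Scope tm_scope.
Declare Scope fm_scope.
Delimit Scope ty_scope with ty.
Delimit Scope tm_scope with tm.
Delimit Scope fm_scope with fm.

Inductive ty : Set := N | Arr (s t : ty).
Bind Scope ty_scope with ty.
Notation "s ~> t" := (Arr s t) (at level 60, right associativity) : ty_scope.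
Open Scope ty_scope.

Notation ty1 := (N ~> N).
Notation ty2 := ((N ~> N) ~> N).

(* Syntax is intrinsically typed and well scoped: [V s] is the set of free
   variables of type [s], and [ext V s] adds one fresh variable of type [s]
   (de Bruijn index 0). *)
Definition vars := ty -> Set.

Inductive ext (V : vars) (s : ty) : vars :=
| vz : ext V s s
| vs : forall t, V t -> ext V s t.

Definition none : vars := fun _ => Empty_set.

Inductive tm (V : vars) : ty -> Set :=
| Var : forall s, V s -> tm V s
| App : forall s t, tm V (s ~> t) -> tm V s -> tm V t
| Zero : tm V N
| Succ : tm V (N ~> N)
| Kc : forall s t, tm V (s ~> t ~> s)
| Sc : forall r s t, tm V ((r ~> s ~> t) ~> (r ~> s) ~> r ~> t)
| Rec : forall s, tm V (N ~> s ~> (s ~> N ~> s) ~> s).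
Bind Scope tm_scope with tm.
Notation "f @ x" := (App f x) (at level 25, left associativity) : tm_scope.
Open Scope tm_scope.

Definition renaming (V W : vars) := forall s, V s -> W s.
Definition substitution (V W : vars) := forall s, V s -> tm W s.

Fixpoint sub_tm {V W s} (f : substitution V W) (t : tm V s) : tm W s :=
  match t with
  | Var x => f _ x
  | App u v => sub_tm f u @ sub_tm f v
  | Zero => Zero
  | Succ => Succ
  | Kc => Kc
  | Sc => Sc
  | Rec => Rec
  end.

Definition ren_tm {V W s} (f : renaming V W) : tm V s -> tm W s :=
  sub_tm (fun _ x => Var (f _ x)).

Definition wk {V s t} : tm V t -> tm (ext V s) t := ren_tm (@vs V s).
Definition v0 {V s} : tm (ext V s) s := Var vz.
Definition v1 {V s t} : tm (ext (ext V s) t) s := Var (vs vz).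

Definition up_ren {V W s} (f : renaming V W) : renaming (ext V s) (ext W s) :=
  fun _ x => match x with vz => vz | vs y => vs (f _ y) end.

Definition up {V W s} (f : substitution V W) : substitution (ext V s) (ext W s) :=
  fun _ x => match x with vz => v0 | vs y => wk (f _ y) end.

Definition inst {V s} (t : tm V s) : substitution (ext V s) V :=
  fun _ x =>
    match x in ext _ _ s' return tm V s -> tm V s' with
    | vz => fun t => t
    | vs y => fun _ => Var y
    end t.

(* The only primitive equality is that of type [N]; [St] is the standardness
   predicate.  The logic is classical, so the remaining connectives and the
   existential quantifier are defined. *)
Inductive fm (V : vars) : Set :=
| Bot : fm V
| Eq : tm V N -> tm V N -> fm V
| St : forall s, tm V s -> fm V
| Imp : fm V -> fm V -> fm V
| All : forall s, fm (ext V s) -> fm V.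
Bind Scope fm_scope with fm.
Arguments All {V} s _.

Fixpoint sub_fm {V W} (f : substitution V W) (A : fm V) : fm W :=
  match A with
  | Bot => Bot
  | Eq a b => Eq (sub_tm f a) (sub_tm f b)
  | St t => St (sub_tm f t)
  | Imp B C => Imp (sub_fm f B) (sub_fm f C)
  | All _ B => All _ (sub_fm (up f) B)
  end.

Definition ren_fm {V W} (f : renaming V W) : fm V -> fm W :=
  sub_fm (fun _ x => Var (f _ x)).

Definition Not {V} (A : fm V) : fm V := Imp A Bot.
Definition And {V} (A B : fm V) : fm V := Not (Imp A (Not B)).
Definition Iff {V} (A B : fm V) : fm V := And (Imp A B) (Imp B A).
Definition Ex {V} s (A : fm (ext V s)) : fm V := Not (All s (Not A)).
Arguments Ex {V} s _.

Notation "A ==> B" := (Imp A B) (at level 85, right associativity) : fm_scope.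
Notation "A <==> B" := (Iff A B) (at level 86, no associativity) : fm_scope.
Notation "A & B" := (And A B) (at level 80, right associativity) : fm_scope.
Notation "! A" := (Not A) (at level 75, right associativity) : fm_scope.
Notation "a == b" := (Eq a b) (at level 70, no associativity) : fm_scope.
Open Scope fm_scope.

Definition AllSt {V} s (A : fm (ext V s)) : fm V := All s (St v0 ==> A).
Definition ExSt {V} s (A : fm (ext V s)) : fm V := Ex s (St v0 & A).
Arguments AllSt {V} s _.
Arguments ExSt {V} s _.

Fixpoint internal {V} (A : fm V) : Prop :=
  match A with
  | Bot | Eq _ _ => True
  | St _ => False
  | Imp B C => internal B /\ internal C
  | All _ B => internal B
  end.

Fixpoint EqAt {V} (s : ty) : tm V s -> tm V s -> fm V :=
  match s return tm V s -> tm V s -> fm V with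
  | N => fun x y => x == y
  | Arr s t => fun x y => All s (EqAt (wk x @ v0) (wk y @ v0))
  end.

(* Bracket abstraction: [lam t] is the combinatory term for [\x. t], where [x]
   is de Bruijn index 0. *)
Fixpoint lam {V s t} (u : tm (ext V s) t) : tm V (s ~> t) :=
  match u in tm _ t return tm V (s ~> t) with
  | Var x =>
      match x in ext _ _ t return tm V (s ~> t) with
      | vz => Sc @ Kc @ (Kc : tm V (s ~> s ~> s))
      | vs y => Kc @ Var y
      end
  | App f a => Sc @ lam f @ lam a
  | Zero => Kc @ Zero
  | Succ => Kc @ Succ
  | Kc => Kc @ Kc
  | Sc => Kc @ Sc
  | Rec => Kc @ Rec
  end.

Definition one {V} : tm V N := Succ @ Zero.

(* Primitive recursion on [n]: in [step], [v1] is the previous value and [v0]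
   the index. *)
Definition primrec {V s} (n : tm V N) (base : tm V s)
    (step : tm (ext (ext V s) N) s) : tm V s :=
  Rec @ n @ base @ lam (lam step).

Definition ifz {V s} (n : tm V N) (a b : tm V s) : tm V s :=
  primrec n a (wk (wk b)).

Definition add {V} (a b : tm V N) : tm V N := primrec b a (Succ @ v1).
Definition mul {V} (a b : tm V N) : tm V N := primrec b Zero (add v1 (wk (wk a))).
Definition predN {V} (a : tm V N) : tm V N := primrec a Zero v0.
Definition monus {V} (a b : tm V N) : tm V N := primrec b a (predN v1).
Definition pow2 {V} (n : tm V N) : tm V N := primrec n one (add v1 v1).

Notation "a + b" := (add a b) : tm_scope.
Notation "a * b" := (mul a b) : tm_scope.
Notation "a - b" := (monus a b) : tm_scope.

(* Cantor pairing [pairN a b = tri (a + b) + a].  The diagonal [diag c] is the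
   largest [d] with [tri d <= c]. *)
Definition tri {V} (n : tm V N) : tm V N := primrec n Zero (v1 + Succ @ v0).
Definition pairN {V} (a b : tm V N) : tm V N := tri (a + b) + a.
Definition diag {V} (c : tm V N) : tm V N :=
  primrec c Zero (ifz (tri (Succ @ v1) - Succ @ v0) (Succ @ v1) v1).
Definition pi1 {V} (c : tm V N) : tm V N := c - tri (diag c).
Definition pi2 {V} (c : tm V N) : tm V N := diag c - pi1 c.

Definition Le {V} (a b : tm V N) : fm V := Ex N (wk a + v0 == wk b).
Definition Lt {V} (a b : tm V N) : fm V := Le (Succ @ a) b.

Fixpoint Maj {V} (s : ty) : tm V s -> tm V s -> fm V :=
  match s return tm V s -> tm V s -> fm V with
  | N => fun x y => Le x y
  | Arr s t => fun x y =>
      All s (All s (Maj v0 v1 ==>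
        Maj (wk (wk x) @ v0) (wk (wk y) @ v1) &
        Maj (wk (wk y) @ v0) (wk (wk y) @ v1)))
  end.

Definition AllMonSt {V} s (A : fm (ext V s)) : fm V := AllSt s (Maj v0 v0 ==> A).
Definition ExMonSt {V} s (A : fm (ext V s)) : fm V := ExSt s (Maj v0 v0 & A).
Arguments AllMonSt {V} s _.
Arguments ExMonSt {V} s _.

(* Axioms have free variables and metavariables for terms; generalization in
   the calculus below yields their universal closures. *)
Inductive EPA {V} : fm V -> Prop :=
| eq_refl_ax (x : tm V N) : EPA (x == x)
| eq_sym_ax (x y : tm V N) : EPA (x == y ==> y == x)
| eq_trans_ax (x y z : tm V N) : EPA (x == y ==> y == z ==> x == z)
| succ_nonzero_ax (x : tm V N) : EPA (! Succ @ x == Zero)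
| succ_inj_ax (x y : tm V N) : EPA (Succ @ x == Succ @ y ==> x == y)
| K_ax s t (x : tm V s) (y : tm V t) : EPA (EqAt (Kc @ x @ y) x)
| S_ax r s t (x : tm V (r ~> s ~> t)) (y : tm V (r ~> s)) (z : tm V r) :
    EPA (EqAt (Sc @ x @ y @ z) (x @ z @ (y @ z)))
| rec_zero_ax s (y : tm V s) (z : tm V (s ~> N ~> s)) :
    EPA (EqAt (Rec @ Zero @ y @ z) y)
| rec_succ_ax s (x : tm V N) (y : tm V s) (z : tm V (s ~> N ~> s)) :
    EPA (EqAt (Rec @ (Succ @ x) @ y @ z) (z @ (Rec @ x @ y @ z) @ x))
| extensionality_ax s t (z : tm V (s ~> t)) (x y : tm V s) :
    EPA (EqAt x y ==> EqAt (z @ x) (z @ y))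
| induction_ax (A : fm (ext V N)) :
    internal A ->
    EPA (sub_fm (inst Zero) A &
         All N (A ==> sub_fm (inst (Succ @ v0)) (ren_fm (up_ren (@vs V N)) A)) ==>
         All N A).

Definition embed_closed {V s} (t : tm none s) : tm V s :=
  sub_tm (fun r (x : none r) => match x with end) t.

Inductive EPAst {V} : fm V -> Prop :=
| EPAst_EPA (A : fm V) : EPA A -> EPAst A
| st_eq_ax s (x y : tm V s) : EPAst (EqAt x y ==> St x ==> St y)
| st_maj_ax s (x y : tm V s) : EPAst (St y ==> Maj x y ==> St x)
| st_closed_ax s (t : tm none s) : EPAst (St (embed_closed (V := V) t))
| st_app_ax s t (z : tm V (s ~> t)) (x : tm V s) :
    EPAst (St z ==> St x ==> St (z @ x))
| external_induction_ax (A : fm (ext V N)) :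
    EPAst (sub_fm (inst Zero) A &
           AllSt N (A ==> sub_fm (inst (Succ @ v0)) (ren_fm (up_ren (@vs V N)) A)) ==>
           AllSt N A).

(* The renaming [up_ren (up_ren vs)] inserts, below the two innermost
   variables, the variable bound by the new outer quantifier. *)
Inductive M {V} : fm V -> Prop :=
| M_EPAst (A : fm V) : EPAst A -> M A
| mAC_ax s t (A : fm (ext (ext V s) t)) :
    internal A ->
    M (AllMonSt s (ExMonSt t A) ==>
       ExMonSt (s ~> t) (AllMonSt s (Ex t (
         Maj v0 (wk (v1 @ v0)) & ren_fm (up_ren (up_ren (@vs V (s ~> t)))) A))))
| R_ax s t (A : fm (ext (ext V s) t)) :
    internal A ->
    M (All s (ExSt t A) ==>
       ExMonSt t (All s (Ex t (
         Maj v0 (wk v1) & ren_fm (up_ren (up_ren (@vs V t))) A))))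
| MAJ_ax s : M (AllSt s (ExSt s (Maj v1 v0))).

Inductive derives (Ax : forall V, fm V -> Prop) :
  forall V : vars, list (fm V) -> fm V -> Prop :=
| d_axiom V (H : list (fm V)) A : Ax V A -> derives Ax H A
| d_hyp V (H : list (fm V)) A : In A H -> derives Ax H A
| d_imp_intro V (H : list (fm V)) A B : derives Ax (A :: H) B -> derives Ax H (A ==> B)
| d_imp_elim V (H : list (fm V)) A B :
    derives Ax H (A ==> B) -> derives Ax H A -> derives Ax H B
| d_raa V (H : list (fm V)) A : derives Ax ((! A) :: H) Bot -> derives Ax H A
| d_all_intro V (H : list (fm V)) s (A : fm (ext V s)) :
    derives Ax (map (ren_fm (@vs V s)) H) A -> derives Ax H (All s A)
| d_all_elim V (H : list (fm V)) s (A : fm (ext V s)) (t : tm V s) :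
    derives Ax H (All s A) -> derives Ax H (sub_fm (inst t) A).

Definition M_proves (A : fm none) : Prop := derives (@M) [] A.

(* Every number codes a rational: [rat p m d] codes [(p - m) / (d + 1)], a
   rational having many codes. *)
Definition rat {V} (p m d : tm V N) : tm V N := pairN (pairN p m) d.
Definition rpos {V} (q : tm V N) : tm V N := pi1 (pi1 q).
Definition rneg {V} (q : tm V N) : tm V N := pi2 (pi1 q).
Definition rden {V} (q : tm V N) : tm V N := Succ @ pi2 q.

Definition subQ {V} (q r : tm V N) : tm V N :=
  rat (rpos q * rden r + rneg r * rden q)
      (rneg q * rden r + rpos r * rden q)
      (predN (rden q * rden r)).
Definition absQ {V} (q : tm V N) : tm V N :=
  rat ((rpos q - rneg q) + (rneg q - rpos q)) Zero (pi2 q).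
Definition LeQ {V} (q r : tm V N) : fm V :=
  Le (rpos q * rden r + rneg r * rden q) (rpos r * rden q + rneg q * rden r).
Definition LtQ {V} (q r : tm V N) : fm V :=
  Lt (rpos q * rden r + rneg r * rden q) (rpos r * rden q + rneg q * rden r).

(* [eps n] is [2^-n]; [eps2 n] is [2^(-n+1)], written [2/2^n] so that [n = 0]
   needs no case distinction. *)
Definition eps {V} (n : tm V N) : tm V N := rat one Zero (predN (pow2 n)).
Definition eps2 {V} (n : tm V N) : tm V N := rat (Succ @ one) Zero (predN (pow2 n)).

(* Quantifiers over reals are relativized to [IsReal] rather than run over all
   sequences of type 1 through a retraction onto the reals: the usual retraction
   (Kohlenbach's hat) is the identity only on sequences with
   [|x n - x (n + 1)| < 2^(-n-1)], which [IsReal] does not imply. *)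
Definition IsReal {V} (x : tm V ty1) : fm V :=
  All N (All N (LtQ (absQ (subQ (wk (wk x) @ v1) (wk (wk x) @ (v1 + v0)))) (eps v1))).

Definition close {V} (x y : tm V ty1) (n : tm V N) : fm V :=
  LeQ (absQ (subQ (x @ n) (y @ n))) (eps2 n).
Definition EqR {V} (x y : tm V ty1) : fm V := All N (close (wk x) (wk y) v0).
Definition Approx {V} (x y : tm V ty1) : fm V := AllSt N (close (wk x) (wk y) v0).
(* The negation of [y <= x], i.e. of [y n - x n <= 2^(-n+1)] for all [n], so that
   [<] and [=] are the strict order and equality of one and the same order. *)
Definition LtR {V} (x y : tm V ty1) : fm V :=
  Ex N (LtQ (eps2 v0) (subQ (wk y @ v0) (wk x @ v0))).
Definition LtLtR {V} (x y : tm V ty1) : fm V := LtR x y & ! Approx y x.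

Definition zeroR {V} : tm V ty1 := lam (rat Zero Zero Zero).

(* The index shift keeps the rate of convergence of [IsReal]. *)
Definition distR {V} (x y : tm V ty1) : tm V ty1 :=
  lam (absQ (subQ (wk x @ (Succ @ v0)) (wk y @ (Succ @ v0)))).

Definition IsSet {V} (U : tm V ty2) : fm V :=
  All ty1 (All ty1 (IsReal v1 ==> IsReal v0 ==> EqR v1 v0 ==>
    wk (wk U) @ v1 == wk (wk U) @ v0)).
Definition InSet {V} (x : tm V ty1) (U : tm V ty2) : fm V := IsReal x & U @ x == one.

Definition OpenSt {V} (U : tm V ty2) : fm V :=
  AllSt ty1 (InSet v0 (wk U) ==>
    ExSt ty1 (IsReal v0 & LtLtR zeroR v0 &
      AllSt ty1 (IsReal v0 ==> LtLtR (distR (wk v1) v0) v1 ==> InSet v0 (wk (wk (wk U)))))).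

Definition OpenNs {V} (U : tm V ty2) : fm V :=
  AllSt ty1 (InSet v0 (wk U) ==>
    All ty1 (IsReal v0 ==> Approx v1 v0 ==> InSet v0 (wk (wk U)))).

(* Main.v *)
From Stdlib Require List Arith Lia Eqdep_dec Cantor Classical ClassicalEpsilon
  FunctionalExtensionality PropExtensionality ProofIrrelevance.
From HB Require Import structures.
From mathcomp Require all_boot all_order all_algebra boolp ring lra.
Require Defs.

(** The statement claims that a formula is derivable, and the proof is semantic:
    by a completeness theorem for the calculus, it suffices that the formula
    holds in every model of the axioms of [M] ([completeness]).  The models are
    extensional, so that equality in all finite types is Leibniz equality and
    one can argue about an arbitrary model as in ordinary mathematics, with the
    proviso that its natural numbers may be nonstandard and that induction is
    only available for sets defined by internal formulas.

    In a model, the natural numbers form an ordered semiring, whose fractions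
    form an ordered field.  Codes of rationals have values in this field, and
    all estimates on reals become linear inequalities there.  It remains to
    compare the two notions of openness of a set [U] of reals, which need not
    itself be standard.

    Let [U] be open relative to the standard objects, [x] in [U] standard and
    [y] infinitely close to [x].  The sequence [y] need not be standard, if only
    because a rational has arbitrarily large codes; but rounding [y (n + 2)] to
    a multiple of [2^-(n+3)] gives a sequence representing the same real, all of
    whose codes are majorized by a sequence computed from [x].  What a standard
    object majorizes is standard, so this rounding [z] is standard
    ([std_real_near]).  Its distance to [x] is infinitesimal, hence far below
    any standard radius that is not itself infinitesimal
    ([ltr_of_infinitesimal]); so [z] is in [U], and so is [y], as [U] respects
    equality of reals ([open_st_ns]).

    Conversely, let [U] be open in the nonstandard sense and [x] in [U] be
    standard.  Every real [y] either lies in [U] or is separated from [x] at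
    some standard index [n].  Realization bounds [n] by one standard [z] for all
    [y] at once: a real whose approximations agree with those of [x] up to the
    index [z] lies in [U].  The radius [2^-(z+1)] then works.  Reals at a smaller
    distance than this may still have approximations that disagree slightly too
    much at the index [n], because the errors of both sequences add up; but the
    shifted sequence [y (n + 1)] represents the same real with errors half as
    large, and it passes the test ([near_shift], [open_ns_st]). *)

Module Completeness.
Import List ListNotations Arith Lia Eqdep_dec Cantor Classical ClassicalEpsilon
  FunctionalExtensionality PropExtensionality ProofIrrelevance Defs.
Set Implicit Arguments.
Unset Strict Implicit.
Unset Asymmetric Patterns.
Set Bullet Behavior "Strict Subproofs".
Implicit Types V W X : vars.

(** * Substitution *)

Lemma sub_tm_comp V W X (f : substitution V W) (g : substitution W X) s (t : tm V s) :
  sub_tm g (sub_tm f t) = sub_tm (fun r x => sub_tm g (f r x)) t.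
Proof. induction t; simpl; congruence. Qed.

Lemma sub_tm_Var V s (t : tm V s) : sub_tm (fun r x => Var x) t = t.
Proof. induction t; simpl; congruence. Qed.

Lemma sub_ext V W (f g : substitution V W) :
  (forall s x, f s x = g s x) -> f = g.
Proof. intro H; do 2 (apply functional_extensionality_dep; intro); apply H. Qed.

Lemma sub_tm_wk V W s (f : substitution V W) r (t : tm V r) :
  sub_tm (up f) (wk t : tm (ext V s) r) = wk (sub_tm f t).
Proof. unfold wk, ren_tm; rewrite !sub_tm_comp; reflexivity. Qed.

Lemma up_comp V W X (f : substitution V W) (g : substitution W X) s :
  (fun r x => sub_tm (up g) (up f x)) = up (s := s) (fun r x => sub_tm g (f r x)).
Proof.
  apply sub_ext; intros r x; destruct x; simpl; [reflexivity|apply sub_tm_wk].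
Qed.

Lemma up_Var V s : up (s := s) (fun r (x : V r) => Var x) = fun r x => Var x.
Proof. apply sub_ext; intros r x; destruct x; reflexivity. Qed.

Lemma sub_fm_comp V (A : fm V) : forall W X (f : substitution V W) (g : substitution W X),
  sub_fm g (sub_fm f A) = sub_fm (fun r x => sub_tm g (f r x)) A.
Proof.
  induction A as [|V a b|V r t|V A1 IHA1 A2 IHA2|V r A IHA]; intros; simpl.
  - reflexivity.
  - now rewrite !sub_tm_comp.
  - now rewrite sub_tm_comp.
  - now rewrite IHA1, IHA2.
  - now rewrite IHA, up_comp.
Qed.

Lemma sub_fm_Var V (A : fm V) : sub_fm (fun r x => Var x) A = A.
Proof.
  induction A as [|V a b|V r t|V A1 IHA1 A2 IHA2|V r A IHA]; simpl.
  - reflexivity.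
  - now rewrite !sub_tm_Var.
  - now rewrite sub_tm_Var.
  - now rewrite IHA1, IHA2.
  - now rewrite up_Var, IHA.
Qed.

Lemma sub_fm_ext V W (f g : substitution V W) (A : fm V) :
  (forall s x, f s x = g s x) -> sub_fm f A = sub_fm g A.
Proof. intro H; now rewrite (sub_ext H). Qed.

Lemma inst_wk V s (t : tm V s) r (u : tm V r) : sub_tm (inst t) (wk u) = u.
Proof. unfold wk, ren_tm; rewrite sub_tm_comp; apply sub_tm_Var. Qed.

Definition scons V W (f : substitution V W) s (t : tm W s) : substitution (ext V s) W :=
  fun r x => match x in ext _ _ r' return tm W s -> tm W r' with
             | vz => fun t => t
             | vs y => fun _ => f _ y
             end t.

Lemma sub_inst V W (f : substitution V W) s (t : tm V s) (A : fm (ext V s)) :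
  sub_fm f (sub_fm (inst t) A) = sub_fm (inst (sub_tm f t)) (sub_fm (up f) A).
Proof.
  rewrite !sub_fm_comp; apply sub_fm_ext; intros r x; destruct x; simpl;
    [reflexivity|now rewrite inst_wk].
Qed.

Lemma inst_up V W (f : substitution V W) s (t : tm W s) (A : fm (ext V s)) :
  sub_fm (inst t) (sub_fm (up f) A) = sub_fm (scons f t) A.
Proof.
  rewrite sub_fm_comp; apply sub_fm_ext; intros r x; destruct x; simpl;
    [reflexivity|now rewrite inst_wk].
Qed.

Lemma sub_EqAt V W (f : substitution V W) s (x y : tm V s) :
  sub_fm f (EqAt x y) = EqAt (sub_tm f x) (sub_tm f y).
Proof.
  revert V W f x y; induction s; intros; simpl; [reflexivity|].
  rewrite IHs2; simpl; now rewrite !sub_tm_wk.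
Qed.

Lemma sub_Maj V W (f : substitution V W) s (x y : tm V s) :
  sub_fm f (Maj x y) = Maj (sub_tm f x) (sub_tm f y).
Proof.
  revert V W f x y; induction s; intros; simpl.
  - unfold Le, Ex, Not; simpl; now rewrite !sub_tm_wk.
  - rewrite !IHs1; unfold And, Not; simpl; rewrite !IHs2; simpl.
    now rewrite !sub_tm_wk.
Qed.

Lemma internal_sub V (A : fm V) : forall W (f : substitution V W),
  internal A -> internal (sub_fm f A).
Proof. induction A; simpl; intros; intuition. Qed.

Lemma sub_embed_closed V W (f : substitution V W) s (t : tm none s) :
  sub_tm f (embed_closed t) = embed_closed t.
Proof.
  unfold embed_closed; rewrite sub_tm_comp; f_equal; apply sub_ext; intros r x; destruct x.
Qed.

(** The two schemes of induction and those of choice and realization rename the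
    variables of their instances; the next two lemmas carry a substitution
    through these renamings. *)
Lemma sub_succ_step V W (f : substitution V W) (A : fm (ext V N)) :
  sub_fm (up f) (sub_fm (inst (Succ @ v0)) (ren_fm (up_ren (@vs V N)) A)) =
  sub_fm (inst (Succ @ v0)) (ren_fm (up_ren (@vs W N)) (sub_fm (up f) A)).
Proof.
  unfold ren_fm; rewrite !sub_fm_comp; apply sub_fm_ext; intros r x; destruct x; simpl;
    [reflexivity|].
  unfold wk, ren_tm; rewrite !sub_tm_comp; reflexivity.
Qed.

Lemma sub_insert V W (f : substitution V W) q s t (A : fm (ext (ext V s) t)) :
  sub_fm (up (up (up f))) (ren_fm (up_ren (up_ren (@vs V q))) A) =
  ren_fm (up_ren (up_ren (@vs W q))) (sub_fm (up (up f)) A).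
Proof.
  unfold ren_fm; rewrite !sub_fm_comp; apply sub_fm_ext; intros r x.
  destruct x as [|? x]; [reflexivity|]; destruct x; [reflexivity|]; simpl.
  unfold wk, ren_tm; rewrite !sub_tm_comp; reflexivity.
Qed.

(** * The axioms are closed under substitution *)

Lemma EPA_sub V W (f : substitution V W) (A : fm V) : EPA A -> EPA (sub_fm f A).
Proof.
  destruct 1; simpl; rewrite ?sub_EqAt; simpl; try constructor.
  rewrite sub_inst, sub_succ_step; constructor; now apply internal_sub.
Qed.

Lemma EPAst_sub V W (f : substitution V W) (A : fm V) : EPAst A -> EPAst (sub_fm f A).
Proof.
  destruct 1; simpl; rewrite ?sub_EqAt, ?sub_Maj, ?sub_embed_closed; simpl.
  - now apply EPAst_EPA, EPA_sub.
  - apply st_eq_ax.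
  - apply st_maj_ax.
  - apply st_closed_ax.
  - apply st_app_ax.
  - rewrite sub_inst, sub_succ_step; apply external_induction_ax.
Qed.

(** Needed twice: derivations are renamed when a variable is generalized, and
    the values of parameters in a model are substituted into the axioms. *)
Lemma M_sub V W (f : substitution V W) (A : fm V) : M A -> M (sub_fm f A).
Proof.
  destruct 1.
  - constructor; now apply EPAst_sub.
  - simpl; rewrite !sub_Maj, sub_insert; simpl.
    apply mAC_ax; now apply internal_sub.
  - simpl; rewrite !sub_Maj, sub_insert; simpl.
    apply R_ax; now apply internal_sub.
  - simpl; rewrite !sub_Maj; simpl; apply MAJ_ax.
Qed.

(** * Derivations *)

Notation proves := (derives (@M)).

Lemma map_sub_wk V W (f : substitution V W) s (H : list (fm V)) :
  map (sub_fm (up f)) (map (ren_fm (@vs V s)) H) = map (ren_fm (@vs W s)) (map (sub_fm f) H).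
Proof.
  rewrite !map_map; apply map_ext; intro A; unfold ren_fm.
  rewrite !sub_fm_comp; reflexivity.
Qed.

Lemma proves_sub V H (A : fm V) : proves H A ->
  forall W (f : substitution V W), proves (map (sub_fm f) H) (sub_fm f A).
Proof.
  induction 1; intros W f.
  - apply d_axiom; now apply M_sub.
  - apply d_hyp; now apply in_map.
  - apply d_imp_intro, IHderives.
  - eapply d_imp_elim; [apply IHderives1|apply IHderives2].
  - apply d_raa, IHderives.
  - simpl; apply d_all_intro; rewrite <- map_sub_wk; apply IHderives.
  - rewrite sub_inst; apply d_all_elim, IHderives.
Qed.

Lemma proves_weak V H (A : fm V) : proves H A -> forall H', incl H H' -> proves H' A.
Proof.
  induction 1; intros H' I.
  - now apply d_axiom.
  - now apply d_hyp, I.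
  - apply d_imp_intro, IHderives; intros x [|]; [left|right]; auto.
  - eapply d_imp_elim; eauto.
  - apply d_raa, IHderives; intros x [|]; [left|right]; auto.
  - apply d_all_intro, IHderives; now apply incl_map.
  - now apply d_all_elim, IHderives.
Qed.

(** * Extension to a Henkin theory *)

(** The term model has countably many variables of each type, which serve as
    Henkin witnesses. *)
Definition W : vars := fun _ => nat.

Lemma ty_eq_dec (s t : ty) : {s = t} + {s <> t}.
Proof. decide equality. Defined.

(** Finite support of terms and formulas.  The measure [m] is there to pass under
    quantifiers, where it counts the bound variable as always in the support. *)
Lemma tm_support V (m : forall s, V s -> nat) s (t : tm V s) :
  exists k, forall X (f g : substitution V X),
    (forall r x, m r x < k -> f r x = g r x) -> sub_tm f t = sub_tm g t.
Proof.
  induction t; try (exists 0; reflexivity).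
  - exists (S (m _ v)); simpl; auto.
  - destruct IHt1 as [k1 H1], IHt2 as [k2 H2]; exists (max k1 k2); intros; simpl.
    f_equal; [apply H1|apply H2]; intros; apply H; lia.
Qed.

Lemma fm_support V (A : fm V) : forall (m : forall s, V s -> nat),
  exists k, forall X (f g : substitution V X),
    (forall r x, m r x < k -> f r x = g r x) -> sub_fm f A = sub_fm g A.
Proof.
  induction A as [|V t t0|V r t|V A1 IHA1 A2 IHA2|V r A IHA]; intro m.
  - exists 0; reflexivity.
  - destruct (tm_support m t) as [k1 H1], (tm_support m t0) as [k2 H2].
    exists (max k1 k2); intros; simpl.
    f_equal; [apply H1|apply H2]; intros; apply H; lia.
  - destruct (tm_support m t) as [k1 H1]; exists k1; intros; simpl; f_equal; auto.
  - destruct (IHA1 m) as [k1 H1], (IHA2 m) as [k2 H2]; exists (max k1 k2); intros; simpl.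
    f_equal; [apply H1|apply H2]; intros; apply H; lia.
  - destruct (IHA (fun r x => match x with vz => 0 | vs y => m _ y end)) as [k H].
    exists k; intros X f g E; simpl; f_equal; apply H; intros r0 x.
    destruct x; intro Hx; [reflexivity|]; simpl; now rewrite E.
Qed.

Lemma list_support (H : list (fm W)) : exists k, forall A, In A H ->
  forall X (f g : substitution W X), (forall r x, x < k -> f r x = g r x) -> sub_fm f A = sub_fm g A.
Proof.
  induction H as [|B H IH].
  - exists 0; intros A [].
  - destruct IH as [k1 H1], (fm_support B (fun r (x : W r) => x)) as [k2 H2].
    exists (max k1 k2); intros A [<-|I] X f g E; [apply H2|apply H1; trivial];
      intros; apply E; lia.
Qed.

(** The inverse, on formulas not containing the variable [k] of type [s], of
    instantiating a bound variable by [k]. *)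
Definition abstract_var (s : ty) (k : nat) : renaming W (ext W s) :=
  fun r x => match ty_eq_dec s r with
             | left e => if Nat.eq_dec x k then eq_rect s (ext W s) vz r e
                         else vs (x : W r)
             | right _ => vs (x : W r)
             end.

Arguments abstract_var : clear implicits.

Lemma abstract_var_same s k : abstract_var s k s k = vz.
Proof.
  unfold abstract_var; destruct (ty_eq_dec s s) as [e|]; [|congruence].
  destruct (Nat.eq_dec k k); [|congruence].
  now rewrite <- (eq_rect_eq_dec ty_eq_dec).
Qed.

Lemma abstract_var_other s k r (x : W r) : x < k -> abstract_var s k r x = vs x.
Proof.
  intro L; unfold abstract_var; destruct (ty_eq_dec s r); [|reflexivity].
  destruct (Nat.eq_dec x k); [lia|reflexivity].
Qed.

Definition consistent V (H : list (fm V)) : Prop := ~ proves H Bot.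

(** A fresh variable may be taken as a counterexample to a refuted universal
    statement: from a contradiction, abstracting the variable would derive the
    universal statement itself. *)
Lemma add_witness (H : list (fm W)) s (B : fm (ext W s)) :
  In (! All s B) H -> consistent H ->
  exists c : tm W s, consistent ((! sub_fm (inst c) B) :: H).
Proof.
  intros I C.
  destruct (list_support H) as [k Hk].
  destruct (fm_support B (fun r x => match x with vz => 0 | vs y => y : nat end)) as [l Hl].
  set (c := max k l).
  exists (Var (c : W s)); intro D; apply C.
  eapply d_imp_elim; [apply d_hyp, I|].
  apply d_all_intro.
  apply d_raa in D.
  apply (proves_sub) with (f := fun r x => Var (abstract_var s c r x)) in D.
  replace (map (ren_fm (@vs W s)) H) with
    (map (sub_fm (fun r x => Var (abstract_var s c r x))) H).
  - replace B with (sub_fm (fun r x => Var (abstract_var s c r x))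
      (sub_fm (inst (Var (c : W s))) B)); [exact D|].
    rewrite sub_fm_comp; rewrite <- (sub_fm_Var B) at 2; apply Hl.
    intros r x; destruct x; intro L; simpl; f_equal;
      [apply abstract_var_same|apply abstract_var_other; unfold c; lia].
  - apply map_ext_in; intros A IA; unfold ren_fm; apply Hk; trivial.
    intros r x L; f_equal; apply abstract_var_other; unfold c; lia.
Qed.

(** ** Enumerating the formulas *)

(** Occurrence from some stage on, rather than at some stage, lets the stages of
    the two parts of a compound expression be combined by taking the larger. *)
Definition enumerates V (e : nat -> list (sigT V)) : Prop :=
  forall s (x : V s), exists n, forall n', n <= n' -> In (existT _ s x) (e n').

Fixpoint enum_ty (n : nat) : list ty :=
  match n with
  | 0 => []
  | S n => N :: flat_map (fun s => map (Arr s) (enum_ty n)) (enum_ty n)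
  end.

Lemma enum_ty_all s : exists n, forall n', n <= n' -> In s (enum_ty n').
Proof.
  induction s as [|s [n1 H1] t [n2 H2]].
  - exists 1; intros [|n'] L; [lia|left; reflexivity].
  - exists (S (max n1 n2)); intros [|n'] L; [lia|right].
    apply in_flat_map; exists s; split; [apply H1; lia|].
    apply in_map, H2; lia.
Qed.

Definition app_sig V (f a : sigT (tm V)) : list (sigT (tm V)) :=
  match f with
  | existT _ r f =>
      match r return tm V r -> list (sigT (tm V)) with
      | N => fun _ => []
      | Arr s t => fun f =>
          match ty_eq_dec (projT1 a) s with
          | left e => [existT _ t (f @ eq_rect _ (tm V) (projT2 a) _ e)]
          | right _ => []
          end
      end f
  end.

Definition cast_N V (a : sigT (tm V)) : list (tm V N) :=
  match a with
  | existT _ r a =>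
      match r return tm V r -> list (tm V N) with N => fun a => [a] | _ => fun _ => [] end a
  end.

Section Enumeration.
Variables (V : vars) (e : nat -> list (sigT V)).

Fixpoint enum_tm (n : nat) : list (sigT (tm V)) :=
  match n with
  | 0 => []
  | S n =>
      map (fun x => existT _ (projT1 x) (Var (projT2 x))) (e n) ++
      flat_map (fun f => flat_map (app_sig f) (enum_tm n)) (enum_tm n) ++
      [existT _ _ Zero; existT _ _ Succ] ++
      flat_map (fun r => existT _ _ (@Rec V r) :: flat_map (fun s =>
        existT _ _ (@Kc V r s) :: map (fun t => existT _ _ (@Sc V r s t)) (enum_ty n))
        (enum_ty n)) (enum_ty n)
  end.

Lemma enum_tm_all : enumerates e -> enumerates enum_tm.
Proof.
  intros He s t; induction t as [s x|s t f [n1 H1] a [n2 H2]| | |s t|r s t|s].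
  - destruct (He _ x) as [n H]; exists (S n); intros [|n'] L; [lia|]; simpl.
    apply in_or_app; left; apply in_map_iff; exists (existT _ s x); split; trivial.
    apply H; lia.
  - exists (S (max n1 n2)); intros [|n'] L; [lia|]; simpl.
    apply in_or_app; right; apply in_or_app; left.
    apply in_flat_map; eexists; split; [apply H1; lia|].
    apply in_flat_map; eexists; split; [apply H2; lia|].
    simpl; destruct (ty_eq_dec s s) as [q|]; [|congruence].
    rewrite <- (eq_rect_eq_dec ty_eq_dec); left; reflexivity.
  - exists 1; intros [|n'] L; [lia|]; simpl.
    apply in_or_app; right; apply in_or_app; right; left; reflexivity.
  - exists 1; intros [|n'] L; [lia|]; simpl.
    apply in_or_app; right; apply in_or_app; right; right; left; reflexivity.
  - destruct (enum_ty_all s) as [n1 H1], (enum_ty_all t) as [n2 H2].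
    exists (S (max n1 n2)); intros [|n'] L; [lia|]; simpl.
    apply in_or_app; right; apply in_or_app; right; right; right.
    apply in_flat_map; exists s; split; [apply H1; lia|]; right.
    apply in_flat_map; exists t; split; [apply H2; lia|]; left; reflexivity.
  - destruct (enum_ty_all r) as [n1 H1], (enum_ty_all s) as [n2 H2], (enum_ty_all t) as [n3 H3].
    exists (S (max n1 (max n2 n3))); intros [|n'] L; [lia|]; simpl.
    apply in_or_app; right; apply in_or_app; right; right; right.
    apply in_flat_map; exists r; split; [apply H1; lia|]; right.
    apply in_flat_map; exists s; split; [apply H2; lia|]; right.
    apply in_map_iff; exists t; split; [reflexivity|apply H3; lia].
  - destruct (enum_ty_all s) as [n1 H1].
    exists (S n1); intros [|n'] L; [lia|]; simpl.
    apply in_or_app; right; apply in_or_app; right; right; right.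
    apply in_flat_map; exists s; split; [apply H1; lia|]; left; reflexivity.
Qed.

Definition enum_ext (s : ty) (n : nat) : list (sigT (ext V s)) :=
  existT _ s vz :: map (fun x => existT _ (projT1 x) (vs (projT2 x))) (e n).

Lemma enum_ext_all s : enumerates e -> enumerates (enum_ext s).
Proof.
  intros He r x; destruct x as [|r x].
  - exists 0; left; reflexivity.
  - destruct (He _ x) as [n H]; exists n; intros; right.
    apply in_map_iff; exists (existT _ r x); auto.
Qed.

End Enumeration.

Fixpoint enum_fm (n : nat) (V : vars) (e : nat -> list (sigT V)) : list (fm V) :=
  match n with
  | 0 => []
  | S n =>
      [Bot] ++
      flat_map (fun a => map (Eq a) (flat_map (@cast_N V) (enum_tm e n)))
        (flat_map (@cast_N V) (enum_tm e n)) ++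
      map (fun t => St (projT2 t)) (enum_tm e n) ++
      flat_map (fun A => map (Imp A) (enum_fm n e)) (enum_fm n e) ++
      flat_map (fun s => map (All s) (enum_fm n (enum_ext e s))) (enum_ty n)
  end.

Lemma enum_fm_all V (A : fm V) : forall e, enumerates e ->
  exists n, forall n', n <= n' -> In A (enum_fm n' e).
Proof.
  induction A as [V|V a b|V s t|V A IHA B IHB|V s A IHA]; intros e He.
  - exists 1; intros [|n'] L; [lia|left; reflexivity].
  - destruct (enum_tm_all He a) as [n1 H1], (enum_tm_all He b) as [n2 H2].
    exists (S (max n1 n2)); intros [|n'] L; [lia|]; simpl; right.
    apply in_or_app; left; apply in_flat_map; exists a; split.
    + apply in_flat_map; eexists; split; [apply H1; lia|left; reflexivity].
    + apply in_map, in_flat_map; eexists; split; [apply H2; lia|left; reflexivity].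
  - destruct (enum_tm_all He t) as [n1 H1].
    exists (S n1); intros [|n'] L; [lia|]; simpl; right.
    apply in_or_app; right; apply in_or_app; left.
    apply in_map_iff; exists (existT _ s t); split; [reflexivity|apply H1; lia].
  - destruct (IHA _ He) as [n1 H1], (IHB _ He) as [n2 H2].
    exists (S (max n1 n2)); intros [|n'] L; [lia|]; simpl; right.
    do 2 (apply in_or_app; right); apply in_or_app; left.
    apply in_flat_map; exists A; split; [apply H1; lia|].
    apply in_map, H2; lia.
  - destruct (IHA _ (enum_ext_all (s := s) He)) as [n1 H1], (enum_ty_all s) as [n2 H2].
    exists (S (max n1 n2)); intros [|n'] L; [lia|]; simpl; right.
    do 3 (apply in_or_app; right).
    apply in_flat_map; exists s; split; [apply H2; lia|].
    apply in_map, H1; lia.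
Qed.

(** A pair of a stage and a position in the list of that stage is coded by one
    number, which flattens the stages into one sequence. *)
Lemma formulas_enumerable : exists e : nat -> fm W, forall A, exists n, e n = A.
Proof.
  set (ev := fun n => flat_map (fun s => map (fun k => existT W s k) (seq 0 n)) (enum_ty n)).
  assert (He : enumerates ev).
  { intros s x; destruct (enum_ty_all s) as [n H]; exists (S (max n x)); intros n' L.
    apply in_flat_map; exists s; split; [apply H; lia|].
    apply in_map, in_seq; unfold W in *; lia. }
  pose (p n := fst (Cantor.of_nat n)); pose (q n := snd (Cantor.of_nat n)).
  exists (fun n => nth (p n) (enum_fm (q n) ev) Bot); intro A.
  destruct (enum_fm_all A He) as [n H].
  destruct (In_nth _ _ Bot (H n (le_n n))) as [i [_ Hi]].
  exists (Cantor.to_nat (i, n)); unfold p, q.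
  now rewrite Cantor.cancel_of_to.
Qed.

(** ** The Henkin theory *)

Definition witnessed (H : list (fm W)) (A : fm W) : Prop :=
  match A with
  | All s B => exists c : tm W s, In (! sub_fm (inst c) B) H
  | _ => True
  end.

(** The step of the construction of Lindenbaum and Henkin: a formula is added if
    it is consistent; otherwise its negation is, and comes with a counterexample
    if the formula is universal. *)
Lemma decide_formula (H : list (fm W)) (A : fm W) : consistent H ->
  exists H', incl H H' /\ consistent H' /\ (In A H' \/ In (! A) H' /\ witnessed H' A).
Proof.
  intro C; destruct (classic (consistent (A :: H))) as [C'|C'].
  - exists (A :: H); repeat split; auto using incl_tl, incl_refl; left; left; reflexivity.
  - assert (C1 : consistent ((! A) :: H)).
    { intro D; apply C, (d_imp_elim (A := ! A)); [now apply d_imp_intro|].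
      apply d_imp_intro; now apply NNPP. }
    assert (HI : In (! A) ((! A) :: H)) by (left; reflexivity).
    assert (E : witnessed ((! A) :: H) A -> exists H', incl H H' /\ consistent H' /\
      (In A H' \/ In (! A) H' /\ witnessed H' A)).
    { intro; exists ((! A) :: H); auto using incl_tl, incl_refl. }
    destruct A; try exact (E I).
    destruct (add_witness HI C1) as [c Cc].
    eexists; repeat split; [|exact Cc|].
    + apply incl_tl, incl_tl, incl_refl.
    + right; split; [right; exact HI|]; exists c; left; reflexivity.
Qed.

(** Theories whose members behave as the true formulas of a structure: the
    lemmas [truth_imp] and [truth_all] below are the clauses of truth. *)
Record henkin (T : fm W -> Prop) : Prop := {
  henkin_closed : forall H A, (forall B, In B H -> T B) -> proves H A -> T A;
  henkin_consistent : ~ T Bot;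
  henkin_complete : forall A, T A \/ T (! A);
  henkin_witness : forall s (B : fm (ext W s)), T (! All s B) ->
    exists c : tm W s, T (! sub_fm (inst c) B)
}.

(** The union of an increasing sequence of finite consistent lists, the [n]-th
    step of which decides the [n]-th formula. *)
Lemma henkin_extension (H : list (fm W)) : consistent H ->
  exists T, henkin T /\ forall A, In A H -> T A.
Proof.
  intro C.
  destruct formulas_enumerable as [e He].
  pose (step n (G G' : {G : list (fm W) | consistent G}) :=
    incl (proj1_sig G) (proj1_sig G') /\
    (In (e n) (proj1_sig G') \/ In (! e n) (proj1_sig G') /\ witnessed (proj1_sig G') (e n))).
  assert (next : forall n G, exists G', step n G G').
  { intros n [G CG]; destruct (decide_formula (e n) CG) as (G' & I & C' & D).
    exists (exist _ G' C'); split; assumption. }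
  pose (G := fix G n := match n with
    | 0 => exist _ H C
    | S n => proj1_sig (constructive_indefinite_description _ (next n (G n)))
    end).
  assert (GS : forall n, step n (G n) (G (S n))).
  { intro n; exact (proj2_sig (constructive_indefinite_description _ (next n (G n)))). }
  assert (mono : forall m n, m <= n -> incl (proj1_sig (G m)) (proj1_sig (G n))).
  { induction 1; [apply incl_refl|]; eapply incl_tran; [exact IHle|apply GS]. }
  pose (T A := exists n, In A (proj1_sig (G n))).
  assert (fin : forall L, (forall B, In B L -> T B) -> exists n, incl L (proj1_sig (G n))).
  { induction L as [|B L IH]; intro HL; [exists 0; intros x []|].
    destruct IH as [n Hn]; [intros; apply HL; right; assumption|].
    destruct (HL B (or_introl eq_refl)) as [m Hm].
    exists (max m n); intros x [<-|I]; [apply (mono m)|apply (mono n)]; auto; lia. }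
  assert (dec : forall A, T A \/ T (! A) /\ exists n, witnessed (proj1_sig (G n)) A).
  { intro A; destruct (He A) as [n <-]; destruct (GS n) as [_ [I|[I J]]];
      [left|right; split]; exists (S n); assumption. }
  assert (cons : ~ T Bot).
  { intros [n I]; apply (proj2_sig (G n)); now apply d_hyp. }
  assert (excl : forall A, T A -> T (! A) -> False).
  { intros A HA HN; destruct (fin [A; ! A]) as [n Hn].
    { intros B [<-|[<-|[]]]; assumption. }
    apply (proj2_sig (G n)).
    apply (d_imp_elim (A := A)); apply d_hyp, Hn; [right; left|left]; reflexivity. }
  exists T; split; [|intros A I; exists 0; exact I].
  split.
  - intros L A HL D; destruct (dec A) as [|[HN _]]; trivial; exfalso.
    destruct (fin ((! A) :: L)) as [n Hn]; [intros B [<-|]; auto|].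
    apply (proj2_sig (G n)).
    apply (d_imp_elim (A := A)); [apply d_hyp, Hn; left; reflexivity|].
    eapply proves_weak; [exact D|]; intros x I; apply Hn; right; exact I.
  - exact cons.
  - intro A; destruct (dec A) as [|[]]; auto.
  - intros s B HN; destruct (dec (All s B)) as [HA|[_ [n [c Hc]]]].
    + destruct (excl _ HA HN).
    + exists c, n; exact Hc.
Qed.

Section Truth.
Variables (T : fm W -> Prop) (HT : henkin T).

Lemma truth_axiom A : M A -> T A.
Proof. intro; apply (henkin_closed HT (H := [])); [intros B []|now apply d_axiom]. Qed.

Lemma truth_imp A B : T (A ==> B) <-> (T A -> T B).
Proof.
  split.
  - intros HI HA; apply (henkin_closed HT (H := [A ==> B; A])).
    + intros C [<-|[<-|[]]]; assumption.
    + apply (d_imp_elim (A := A)); apply d_hyp; simpl; auto.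
  - intro I; destruct (henkin_complete HT A) as [HA|HN].
    + apply (henkin_closed HT (H := [B])); [intros C [<-|[]]; auto|].
      apply d_imp_intro, d_hyp; simpl; auto.
    + apply (henkin_closed HT (H := [! A])); [intros C [<-|[]]; auto|].
      apply d_imp_intro, d_raa, (d_imp_elim (A := A)); apply d_hyp; simpl; auto.
Qed.

(** The counterexamples make a universal formula follow from its instances. *)
Lemma truth_all s (B : fm (ext W s)) : T (All s B) <-> forall t, T (sub_fm (inst t) B).
Proof.
  split.
  - intros HA t; apply (henkin_closed HT (H := [All s B])); [intros C [<-|[]]; auto|].
    apply d_all_elim, d_hyp; simpl; auto.
  - intro HA; destruct (henkin_complete HT (All s B)) as [|HN]; trivial; exfalso.
    destruct (henkin_witness HT HN) as [c Hc].
    apply (henkin_consistent HT), (proj1 (truth_imp _ _) Hc), HA.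
Qed.

End Truth.

(** * Models *)

Record structure := {
  dom : ty -> Set;
  app : forall s t, dom (s ~> t) -> dom s -> dom t;
  zero : dom N;
  succ : dom (N ~> N);
  kcomb : forall s t, dom (s ~> t ~> s);
  scomb : forall r s t, dom ((r ~> s ~> t) ~> (r ~> s) ~> r ~> t);
  recursor : forall s, dom (N ~> s ~> (s ~> N ~> s) ~> s);
  std : forall s, dom s -> Prop
}.

Section Semantics.
Variable S : structure.

Definition env (V : vars) := forall s, V s -> dom S s.

Definition econs V (e : env V) s (d : dom S s) : env (ext V s) :=
  fun r x => match x in ext _ _ r' return dom S s -> dom S r' with
             | vz => fun d => d
             | vs y => fun _ => e _ y
             end d.

Fixpoint eval V (e : env V) s (t : tm V s) : dom S s :=
  match t with
  | Var x => e _ x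
  | f @ a => app (eval e f) (eval e a)
  | Zero => zero S
  | Succ => succ S
  | Kc => kcomb S _ _
  | Sc => scomb S _ _ _
  | Rec => recursor S _
  end.

Fixpoint sat V (e : env V) (A : fm V) : Prop :=
  match A with
  | Bot => False
  | a == b => eval e a = eval e b
  | St t => std (eval e t)
  | B ==> C => sat e B -> sat e C
  | All s B => forall d : dom S s, sat (econs e d) B
  end.

Definition extensional : Prop := forall s t (f g : dom S (s ~> t)),
  (forall d, app f d = app g d) -> f = g.

End Semantics.

Record model (S : structure) : Prop := {
  model_ext : extensional S;
  model_sat : forall V (e : env S V) A, M A -> sat e A
}.

(** ** Quotients *)

(** The quotient is the set of chosen representatives, and not the set of
    equivalence classes, so that it stays in [Set]: the elements of a model are
    later used as variables of formulas, which must form a [Set]. *)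
Section Quotient.
Variables (T : Set) (R : T -> T -> Prop).
Hypotheses (R_refl : forall x, R x x) (R_sym : forall x y, R x y -> R y x)
  (R_trans : forall x y z, R x y -> R y z -> R x z).

Definition rep_of (x : T) : T := epsilon (inhabits x) (R x).
Definition quot : Set := {x : T | rep_of x = x}.
Definition rep (q : quot) : T := proj1_sig q.

Lemma rep_ofP x : R x (rep_of x).
Proof. exact (epsilon_spec (inhabits x) (R x) (ex_intro _ x (R_refl x))). Qed.

Lemma rep_of_eq x y : R x y -> rep_of x = rep_of y.
Proof.
  intro H; unfold rep_of.
  replace (inhabits y) with (inhabits x) by apply proof_irrelevance.
  f_equal; apply functional_extensionality; intro z; apply propositional_extensionality.
  split; intro; eauto.
Qed.

Definition class (x : T) : quot :=
  exist _ (rep_of x) (eq_sym (rep_of_eq (rep_ofP x))).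

Lemma class_eq x y : R x y <-> class x = class y.
Proof.
  split; intro H.
  - apply eq_sig_hprop; [intros; apply proof_irrelevance|]; simpl; now apply rep_of_eq.
  - apply R_trans with (rep_of x); [apply rep_ofP|].
    change (R (rep (class x)) y); rewrite H; apply R_sym, rep_ofP.
Qed.

Lemma repK q : class (rep q) = q.
Proof.
  destruct q as [x E]; apply eq_sig_hprop; [intros; apply proof_irrelevance|]; exact E.
Qed.

Lemma rep_class x : R (rep (class x)) x.
Proof. apply class_eq, repK. Qed.
End Quotient.

(** ** The term model *)

Section TermModel.
Variables (T : fm W -> Prop) (HT : henkin T).

(** Provable extensional equality; dividing by it makes the term model
    extensional in the sense of Leibniz equality. *)
Definition teq s (x y : tm W s) : Prop := T (EqAt x y).

Lemma teq_arr s t (f g : tm W (s ~> t)) :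
  teq f g <-> forall a, teq (f @ a) (g @ a).
Proof.
  unfold teq; simpl; rewrite (truth_all HT).
  split; intros H a; specialize (H a); rewrite sub_EqAt in *; simpl in *;
    rewrite !inst_wk in *; exact H.
Qed.

Lemma truth_EPA A : EPA A -> T A.
Proof. intro; now apply (truth_axiom HT), M_EPAst, EPAst_EPA. Qed.

Lemma teq_refl s (x : tm W s) : teq x x.
Proof.
  induction s; [apply truth_EPA, eq_refl_ax|apply teq_arr; auto].
Qed.

Lemma teq_sym s (x y : tm W s) : teq x y -> teq y x.
Proof.
  induction s.
  - apply (truth_imp HT), truth_EPA, eq_sym_ax.
  - rewrite !teq_arr; auto.
Qed.

Lemma teq_trans s (x y z : tm W s) : teq x y -> teq y z -> teq x z.
Proof.
  induction s.
  - intro H; apply (truth_imp HT); revert H; apply (truth_imp HT), truth_EPA, eq_trans_ax.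
  - rewrite !teq_arr; intros H1 H2 a; eauto.
Qed.

Lemma teq_app s t (f g : tm W (s ~> t)) a b : teq f g -> teq a b -> teq (f @ a) (g @ b).
Proof.
  intros Hf Ha; apply teq_trans with (g @ a); [now apply teq_arr|].
  revert Ha; apply (truth_imp HT), truth_EPA, extensionality_ax.
Qed.

Definition tdom (s : ty) : Set := quot (teq (s := s)).
Definition tclass s (t : tm W s) : tdom s :=
  class (@teq_refl s) (@teq_sym s) (@teq_trans s) t.

Lemma tclass_eq s (x y : tm W s) : teq x y <-> tclass x = tclass y.
Proof. apply class_eq. Qed.

Lemma tclass_rep s (q : tdom s) : tclass (rep q) = q.
Proof. apply repK. Qed.

Lemma rep_tclass s (t : tm W s) : teq (rep (tclass t)) t.
Proof. apply rep_class. Qed.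

Definition term_structure : structure := {|
  dom := tdom;
  app := fun s t f a => tclass (rep f @ rep a);
  zero := tclass Zero;
  succ := tclass Succ;
  kcomb := fun s t => tclass Kc;
  scomb := fun r s t => tclass Sc;
  recursor := fun s => tclass Rec;
  std := fun s d => T (St (rep d))
|}.

Definition tenv V (f : substitution V W) : env term_structure V :=
  fun s x => tclass (f s x).

Lemma tenv_surj V (e : env term_structure V) : exists f, e = tenv f.
Proof.
  exists (fun s x => rep (e s x)).
  do 2 (apply functional_extensionality_dep; intro); symmetry; apply tclass_rep.
Qed.

Lemma eval_term V (f : substitution V W) s (t : tm V s) :
  eval (tenv f) t = tclass (sub_tm f t).
Proof.
  induction t; simpl; trivial.
  rewrite IHt1, IHt2; apply tclass_eq, teq_app; apply rep_tclass.
Qed.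

Lemma sat_term V (A : fm V) : forall f : substitution V W,
  sat (tenv f) A <-> T (sub_fm f A).
Proof.
  induction A as [|V a b|V r t|V A IHA B IHB|V r A IHA]; intro f; simpl.
  - split; [tauto|apply (henkin_consistent HT)].
  - rewrite !eval_term; symmetry; exact (tclass_eq (sub_tm f a) (sub_tm f b)).
  - rewrite eval_term; simpl.
    split; apply (truth_imp HT);
      [pose proof (rep_tclass (sub_tm f t)) as H
      |pose proof (teq_sym (rep_tclass (sub_tm f t))) as H];
      revert H; apply (truth_imp HT), (truth_axiom HT), M_EPAst, st_eq_ax.
  - now rewrite IHA, IHB, (truth_imp HT).
  - rewrite (truth_all HT).
    assert (E : forall t : tm W r, econs (tenv f) (tclass t) = tenv (scons f t)).
    { intro t; do 2 (apply functional_extensionality_dep; intro).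
      destruct x0; reflexivity. }
    split; intros H t.
    + rewrite inst_up, <- IHA, <- E; apply H.
    + simpl in t; rewrite <- (tclass_rep t), E, IHA, <- inst_up; apply H.
Qed.

Lemma term_model : model term_structure.
Proof.
  split.
  - intros s t f g H; simpl in *.
    rewrite <- (tclass_rep f), <- (tclass_rep g); apply tclass_eq, teq_arr; intro a.
    apply teq_trans with (rep f @ rep (tclass a)).
    { apply teq_app; [apply teq_refl|apply teq_sym, rep_tclass]. }
    apply teq_trans with (rep g @ rep (tclass a)).
    { apply tclass_eq, H. }
    apply teq_app; [apply teq_refl|apply rep_tclass].
  - intros V e A HA; destruct (tenv_surj e) as [f ->].
    now apply sat_term, (truth_axiom HT), M_sub.
Qed.
End TermModel.

Fixpoint closed_term (s : ty) : tm none s :=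
  match s with
  | N => Zero
  | s ~> t => Kc @ closed_term t
  end.

(** A formula that is not derivable is refuted by the term model of a Henkin
    theory containing its negation.  The variables of this theory are eliminated
    by substituting closed terms, since every type has one. *)
Theorem completeness (A : fm none) :
  (forall S, model S -> forall e : env S none, sat e A) -> M_proves A.
Proof.
  intro H; apply NNPP; intro HA.
  pose (i := (fun s (x : none s) => match x with end) : substitution none W).
  assert (C : consistent [! sub_fm i A]).
  { intro D; apply HA; apply d_raa in D.
    apply proves_sub with (f := fun s _ => closed_term s) in D; simpl in D.
    rewrite sub_fm_comp in D; rewrite <- (sub_fm_Var A).
    erewrite sub_fm_ext; [exact D|]; intros s []. }
  destruct (henkin_extension C) as (T & HT & HN).
  apply (henkin_consistent HT).
  apply (proj1 (truth_imp HT (sub_fm i A) Bot)); [apply HN; left; reflexivity|].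
  apply (sat_term HT), H, term_model.
Qed.
End Completeness.

Module ModelArithmetic.
Import Classical FunctionalExtensionality Defs Completeness.
Set Implicit Arguments.
Unset Strict Implicit.
Unset Asymmetric Patterns.
Set Bullet Behavior "Strict Subproofs".
Implicit Types V W X : vars.

(** * Arithmetic in a model *)

Section Model.
Variables (S : structure) (HS : model S).
Implicit Types a b c m n : dom S N.

Lemma env_ext V (e f : env S V) : (forall s x, e s x = f s x) -> e = f.
Proof. intro H; do 2 (apply functional_extensionality_dep; intro); apply H. Qed.

Lemma econs_eta V (e : env S V) s (d : dom S s) (f : env S (ext V s)) :
  f s vz = d -> (forall r x, f r (vs x) = e r x) -> f = econs e d.
Proof. intros H0 H1; apply env_ext; intros r x; destruct x; simpl; auto. Qed.

Lemma eval_sub V W (f : substitution V W) (e : env S W) s (t : tm V s) :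
  eval e (sub_tm f t) = eval (fun r x => eval e (f r x)) t.
Proof. induction t; simpl; congruence. Qed.

Lemma eval_wk V (e : env S V) s (d : dom S s) r (t : tm V r) :
  eval (econs e d) (wk t) = eval e t.
Proof. unfold wk, ren_tm; rewrite eval_sub; reflexivity. Qed.

Lemma sat_sub V (A : fm V) : forall W (f : substitution V W) (e : env S W),
  sat e (sub_fm f A) <-> sat (fun r x => eval e (f r x)) A.
Proof.
  induction A as [|V a b|V r t|V A1 IHA1 A2 IHA2|V r A IHA]; intros W f e; simpl.
  - tauto.
  - now rewrite !eval_sub.
  - now rewrite eval_sub.
  - now rewrite IHA1, IHA2.
  - assert (E : forall d, (fun q x => eval (econs e d) (up f x)) =
      econs (fun q x => eval e (f q x)) (d : dom S r)).
    { intro d; apply econs_eta; [reflexivity|intros; apply eval_wk]. }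
    split; intros H d; specialize (H d).
    + now rewrite IHA, E in H.
    + now rewrite IHA, E.
Qed.

Lemma sat_inst V (e : env S V) s (t : tm V s) (A : fm (ext V s)) :
  sat e (sub_fm (inst t) A) <-> sat (econs e (eval e t)) A.
Proof.
  rewrite sat_sub.
  rewrite (@econs_eta V e s (eval e t) (fun r x => eval e (@inst V s t r x)));
    reflexivity.
Qed.

Lemma sat_Ex V (e : env S V) s (A : fm (ext V s)) :
  sat e (Ex s A) <-> exists d, sat (econs e d) A.
Proof.
  simpl; split; [|intros [d H] K; apply (K d H)].
  intro H; apply NNPP; intro K; apply H; intros d Hd; apply K; now exists d.
Qed.

Lemma sat_And V (e : env S V) A B : sat e (A & B) <-> sat e A /\ sat e B.
Proof. simpl; split; [|tauto]; intro H; apply NNPP; tauto. Qed.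

Lemma sat_Iff V (e : env S V) A B : sat e (A <==> B) <-> (sat e A <-> sat e B).
Proof. unfold Iff; rewrite sat_And; reflexivity. Qed.

Lemma sat_EqAt V (e : env S V) s (x y : tm V s) :
  sat e (EqAt x y) <-> eval e x = eval e y.
Proof.
  revert V e x y; induction s; intros; simpl; [reflexivity|].
  split; intro H.
  - apply (model_ext HS); intro d; specialize (H d); rewrite IHs2 in H; simpl in H.
    now rewrite !eval_wk in H.
  - intro d; rewrite IHs2; simpl; now rewrite !eval_wk, H.
Qed.

(** The elements of the model serve as names for themselves, so that axioms can
    be instantiated at given elements. *)
Definition params : env S (dom S) := fun s x => x.

Lemma sat_EPA V (e : env S V) A : EPA A -> sat e A.
Proof. intro; now apply (model_sat HS), M_EPAst, EPAst_EPA. Qed.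

Lemma eval_K s t (x : dom S s) (y : dom S t) : app (app (kcomb S s t) x) y = x.
Proof. exact (proj1 (sat_EqAt _ _ _) (sat_EPA params (@K_ax _ _ _ (Var x) (Var y)))). Qed.

Lemma eval_S r s t (x : dom S (r ~> s ~> t)) (y : dom S (r ~> s)) (z : dom S r) :
  app (app (app (scomb S r s t) x) y) z = app (app x z) (app y z).
Proof.
  exact (proj1 (sat_EqAt _ _ _) (sat_EPA params (@S_ax _ _ _ _ (Var x) (Var y) (Var z)))).
Qed.

Lemma eval_lam V (e : env S V) s t (u : tm (ext V s) t) d :
  app (eval e (lam u)) d = eval (econs e d) u.
Proof.
  revert V e s u d.
  enough (H : forall X t (u : tm X t) V s (q : X = ext V s) (e : env S V) (d : dom S s),
    app (eval e (lam (eq_rect X (fun X => tm X t) u _ q))) d =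
    eval (econs e d) (eq_rect X (fun X => tm X t) u _ q)).
  { intros; apply (H _ _ u _ _ eq_refl). }
  intros X r u; induction u; intros V s' q e d; subst X; simpl in *;
    rewrite ?eval_S, ?eval_K; trivial.
  - destruct v; simpl; rewrite ?eval_S, ?eval_K; trivial.
  - specialize (IHu1 _ _ eq_refl e d); specialize (IHu2 _ _ eq_refl e d); simpl in *.
    congruence.
Qed.

Definition sc n : dom S N := app (succ S) n.

Definition prec V (e : env S V) s (b : tm V s) (st : tm (ext (ext V s) N) s) n : dom S s :=
  app (app (app (recursor S s) n) (eval e b)) (eval e (lam (lam st))).

Lemma eval_primrec V (e : env S V) s (u : tm V N) (b : tm V s) st :
  eval e (primrec u b st) = prec e b st (eval e u).
Proof. reflexivity. Qed.

Lemma prec_0 V (e : env S V) s (b : tm V s) st : prec e b st (zero S) = eval e b.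
Proof.
  exact (proj1 (sat_EqAt _ _ _) (sat_EPA e (@rec_zero_ax _ _ b (lam (lam st))))).
Qed.

Lemma prec_S V (e : env S V) s (b : tm V s) st n :
  prec e b st (sc n) = eval (econs (econs e (prec e b st n)) n) st.
Proof.
  rewrite <- !eval_lam.
  exact (proj1 (sat_EqAt _ _ _)
    (sat_EPA params (@rec_succ_ax _ _ (Var n) (Var (eval e b)) (Var (eval e (lam (lam st))))))).
Qed.

(** The term defining a function by recursion contains the terms of its
    parameters under abstractions; extensionality makes its value depend on
    their values alone, which turns the defined operations into operations on
    the model. *)
Lemma prec_ext V W (e : env S V) (f : env S W) s (b : tm V s) (b' : tm W s) st st' n :
  eval e b = eval f b' ->
  (forall p i, eval (econs (econs e p) i) st = eval (econs (econs f p) i) st') ->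
  prec e b st n = prec f b' st' n.
Proof.
  intros Hb H; unfold prec; rewrite Hb; f_equal.
  apply (model_ext HS); intro p; rewrite !eval_lam.
  apply (model_ext HS); intro i; rewrite !eval_lam; apply H.
Qed.

Lemma sc_inj m n : sc m = sc n -> m = n.
Proof. exact (sat_EPA params (@succ_inj_ax _ (Var m) (Var n))). Qed.

Lemma sc_neq0 n : sc n <> zero S.
Proof. exact (sat_EPA params (@succ_nonzero_ax _ (Var n))). Qed.

(** Internal induction for a property that an internal formula defines. *)
Lemma induction_on (P : dom S N -> Prop) V (e : env S V) (A : fm (ext V N)) :
  internal A -> (forall n, sat (econs e n) A <-> P n) ->
  P (zero S) -> (forall n, P n -> P (sc n)) -> forall n, P n.
Proof.
  intros HA HP H0 H1 n; apply HP; revert n.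
  apply (sat_EPA e (@induction_ax _ _ HA)).
  apply sat_And; split; [now apply sat_inst, HP|].
  intros n Hn; apply HP, H1 in Hn; apply HP in Hn.
  rewrite sat_inst; unfold ren_fm; rewrite sat_sub.
  now rewrite (@econs_eta V e N (sc n) (fun r x => eval _ (Var (@up_ren _ _ _ (@vs V N) r x)))).
Qed.

(** ** Addition and multiplication *)

Definition plus a b : dom S N := prec params (Var a) (Succ @ v1) b.

Lemma eval_add V (e : env S V) (a b : tm V N) : eval e (add a b) = plus (eval e a) (eval e b).
Proof. reflexivity. Qed.

Lemma plus_0 a : plus a (zero S) = a.
Proof. apply prec_0. Qed.

Lemma plus_S a b : plus a (sc b) = sc (plus a b).
Proof. unfold plus; rewrite prec_S; reflexivity. Qed.

Definition times a b : dom S N :=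
  prec params Zero (add v1 (wk (wk (Var a)))) b.

Lemma eval_mul V (e : env S V) (a b : tm V N) : eval e (mul a b) = times (eval e a) (eval e b).
Proof.
  unfold mul, times; rewrite eval_primrec; apply prec_ext; [reflexivity|].
  intros p i; now rewrite !eval_add, !eval_wk.
Qed.

Lemma times_0 a : times a (zero S) = zero S.
Proof. apply prec_0. Qed.

Lemma times_S a b : times a (sc b) = plus (times a b) a.
Proof.
  unfold times; rewrite prec_S, eval_add, !eval_wk; reflexivity.
Qed.

Ltac values := cbn [sat eval econs params v0 v1]; rewrite ?eval_mul, ?eval_add;
  cbn [eval econs params v0 v1].

Tactic Notation "poly" uconstr(A) :=
  let n := fresh in
  refine (induction_on (e := params) (A := A) _ _ _ _);
    [simpl; tauto|intro n; values; reflexivity| |].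

Lemma plus_0l b : plus (zero S) b = b.
Proof.
  revert b; poly (Zero + v0 == v0); [apply plus_0|].
  intros n H; now rewrite plus_S, H.
Qed.

Lemma plus_Sl a b : plus (sc a) b = sc (plus a b).
Proof.
  revert b; poly (Succ @ Var (vs a) + v0 == Succ @ (Var (vs a) + v0)).
  - now rewrite !plus_0.
  - intros n H; now rewrite !plus_S, H.
Qed.

Lemma plusC a b : plus a b = plus b a.
Proof.
  revert b; poly (Var (vs a) + v0 == v0 + Var (vs a)).
  - now rewrite plus_0, plus_0l.
  - intros n H; now rewrite plus_S, plus_Sl, H.
Qed.

Lemma plusA a b c : plus a (plus b c) = plus (plus a b) c.
Proof.
  revert c; poly (Var (vs a) + (Var (vs b) + v0) == (Var (vs a) + Var (vs b)) + v0).
  - now rewrite !plus_0.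
  - intros n H; now rewrite !plus_S, H.
Qed.

Lemma plusI a b c : plus a c = plus b c -> a = b.
Proof.
  revert c; poly (Var (vs a) + v0 == Var (vs b) + v0 ==> Var (vs a) == Var (vs b)).
  - now rewrite !plus_0.
  - intros n H; rewrite !plus_S; intro E; now apply H, sc_inj.
Qed.

Lemma times_0l b : times (zero S) b = zero S.
Proof.
  revert b; poly (Zero * v0 == Zero); [apply times_0|].
  intros n H; now rewrite times_S, H, plus_0.
Qed.

Lemma times_Sl a b : times (sc a) b = plus (times a b) b.
Proof.
  revert b; poly ((Succ @ Var (vs a)) * v0 == Var (vs a) * v0 + v0).
  - now rewrite !times_0, plus_0.
  - intros n H; rewrite !times_S, H, !plus_S, <- !plusA; do 2 f_equal; apply plusC.
Qed.

Lemma timesC a b : times a b = times b a.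
Proof.
  revert b; poly (Var (vs a) * v0 == v0 * Var (vs a)).
  - now rewrite times_0, times_0l.
  - intros n H; now rewrite times_S, times_Sl, H.
Qed.

Lemma timesDr a b c : times a (plus b c) = plus (times a b) (times a c).
Proof.
  revert c; poly (Var (vs a) * (Var (vs b) + v0) == Var (vs a) * Var (vs b) + Var (vs a) * v0).
  - now rewrite times_0, !plus_0.
  - intros n H; now rewrite plus_S, !times_S, H, plusA.
Qed.

Lemma timesA a b c : times a (times b c) = times (times a b) c.
Proof.
  revert c; poly (Var (vs a) * (Var (vs b) * v0) == (Var (vs a) * Var (vs b)) * v0).
  - now rewrite !times_0.
  - intros n H; now rewrite !times_S, timesDr, H.
Qed.

Lemma times_1 a : times a (sc (zero S)) = a.
Proof. now rewrite times_S, times_0, plus_0l. Qed.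

Lemma zero_or_succ n : n = zero S \/ exists m, n = sc m.
Proof.
  revert n; apply (induction_on (e := params)
    (A := ! v0 == Zero ==> Ex N (Var (vs vz) == Succ @ v0))); [simpl; tauto| | |].
  - intro n; change ((sat (econs params n) (! v0 == Zero) ->
      sat (econs params n) (Ex N (Var (vs vz) == Succ @ v0))) <->
      (n = zero S \/ exists m, n = sc m)).
    rewrite sat_Ex; simpl.
    unfold sc; tauto.
  - now left.
  - intros n _; right; now exists n.
Qed.

Lemma plus_eq0 a b : plus a b = zero S -> b = zero S.
Proof.
  destruct (zero_or_succ b) as [->|[c ->]]; [reflexivity|].
  rewrite plus_S; intro H; destruct (sc_neq0 H).
Qed.

Lemma times_eq0 a b : times a b = zero S -> a = zero S \/ b = zero S.
Proof.
  destruct (zero_or_succ b) as [->|[c ->]]; [auto|].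
  rewrite times_S; intro H; left; exact (plus_eq0 H).
Qed.

Lemma plus_total a b : exists c, plus a c = b \/ plus b c = a.
Proof.
  revert a; apply (induction_on (e := params)
    (A := Ex N (! v1 + v0 == Var (vs (vs b)) ==> Var (vs (vs b)) + v0 == v1)));
    [simpl; tauto| | |].
  - intro a; rewrite sat_Ex; split; intros [c Hc]; exists c.
    + apply NNPP; intro K; apply K; right; apply Hc; intro H; apply K; left; exact H.
    + destruct Hc as [H|H]; intro K; [destruct (K H)|exact H].
  - exists b; left; apply plus_0l.
  - intros a [c [H|H]].
    + destruct (zero_or_succ c) as [->|[d ->]].
      * exists (sc (zero S)); right; now rewrite plus_S, <- H, !plus_0.
      * exists d; left; now rewrite plus_Sl, <- plus_S.
    + exists (sc c); right; now rewrite plus_S, H.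
Qed.

(** ** Order *)

Definition le a b : Prop := exists c, plus a c = b.

Lemma sat_Le V (e : env S V) (a b : tm V N) : sat e (Le a b) <-> le (eval e a) (eval e b).
Proof.
  unfold Le; rewrite sat_Ex; split; intros [c H]; exists c; revert H; values;
    rewrite !eval_wk; auto.
Qed.

Lemma sat_Lt V (e : env S V) (a b : tm V N) : sat e (Lt a b) <-> le (sc (eval e a)) (eval e b).
Proof. apply sat_Le. Qed.

Lemma le_refl a : le a a.
Proof. exists (zero S); apply plus_0. Qed.

Lemma le_0 a : le (zero S) a.
Proof. exists a; apply plus_0l. Qed.

Lemma le_trans a b c : le a b -> le b c -> le a c.
Proof. intros [x <-] [y <-]; exists (plus x y); apply plusA. Qed.

Lemma le_plus a b : le a (plus a b).
Proof. now exists b. Qed.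

Lemma le_sc a : le a (sc a).
Proof. exists (sc (zero S)); now rewrite plus_S, plus_0. Qed.

Lemma le_plus2 a b c d : le a b -> le c d -> le (plus a c) (plus b d).
Proof.
  intros [x <-] [y <-]; exists (plus x y).
  now rewrite <- !plusA, (plusA x), (plusC x c), !plusA.
Qed.

Lemma le_times2 a b c d : le a b -> le c d -> le (times a c) (times b d).
Proof.
  intros [x <-] [y <-]; rewrite timesDr, !(timesC (plus a x)), !timesDr, !(timesC _ a).
  rewrite <- !plusA; apply le_plus.
Qed.

Lemma lt_irrefl a : ~ le (sc a) a.
Proof.
  intros [x H]; rewrite plus_Sl, <- plus_S in H.
  apply (@sc_neq0 x), (plusI (c := a)); now rewrite plus_0l, plusC.
Qed.

Lemma le_or_lt a b : le a b \/ le (sc b) a.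
Proof.
  destruct (plus_total a b) as [c [H|H]]; [left; now exists c|].
  destruct (zero_or_succ c) as [->|[d ->]].
  - left; exists (zero S); now rewrite <- H, !plus_0.
  - right; exists d; now rewrite plus_Sl, <- plus_S.
Qed.

Lemma lt_iff a b : le (sc a) b <-> ~ le b a.
Proof.
  split; [intros H K; exact (lt_irrefl (le_trans H K))|].
  destruct (le_or_lt b a); tauto.
Qed.

Lemma le_antisym a b : le a b -> le b a -> a = b.
Proof.
  intros [x <-] [y H]; rewrite <- plusA in H.
  assert (E : plus x y = zero S).
  { apply (plusI (c := a)); now rewrite plus_0l, plusC. }
  rewrite plusC in E; rewrite (plus_eq0 E); symmetry; apply plus_0.
Qed.

Lemma le_SS a b : le (sc a) (sc b) <-> le a b.
Proof.
  split; intros [c H]; exists c; rewrite plus_Sl in *; [now apply sc_inj|now rewrite H].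
Qed.

(** ** The functions of the coding of rationals *)

Definition pre a : dom S N := prec params Zero v0 a.

Lemma pre_S a : pre (sc a) = a.
Proof. unfold pre; now rewrite prec_S. Qed.

Definition minus a b : dom S N := prec params (Var a) (predN v1) b.

Lemma eval_monus V (e : env S V) (a b : tm V N) :
  eval e (monus a b) = minus (eval e a) (eval e b).
Proof. reflexivity. Qed.

Lemma eval_predN V (e : env S V) (a : tm V N) : eval e (predN a) = pre (eval e a).
Proof. reflexivity. Qed.

Lemma minus_0 a : minus a (zero S) = a.
Proof. apply prec_0. Qed.

Lemma minus_S a b : minus a (sc b) = pre (minus a b).
Proof. unfold minus; rewrite prec_S; reflexivity. Qed.

Lemma minus_SS a b : minus (sc a) (sc b) = minus a b.
Proof.
  revert b; poly ((Succ @ Var (vs a)) - (Succ @ v0) == Var (vs a) - v0).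
  - now rewrite minus_S, !minus_0, pre_S.
  - intros n H; now rewrite minus_S, H, minus_S.
Qed.

Lemma minus_plus a c : minus (plus a c) a = c.
Proof.
  revert a; poly (v0 + Var (vs c) - v0 == Var (vs c)).
  - now rewrite minus_0, plus_0l.
  - intros n H; now rewrite plus_Sl, minus_SS.
Qed.

Lemma minus_plus_eq0 a c : minus a (plus a c) = zero S.
Proof.
  revert a; poly (v0 - (v0 + Var (vs c)) == Zero).
  - rewrite plus_0l; revert c; poly (Zero - v0 == Zero); [apply minus_0|].
    intros n H; rewrite minus_S, H; apply prec_0.
  - intros n H; now rewrite plus_Sl, minus_SS.
Qed.

Lemma minus_eq0 a b : minus a b = zero S <-> le a b.
Proof.
  split; [|intros [c <-]; apply minus_plus_eq0].
  destruct (le_or_lt a b) as [|[c <-]]; [trivial|].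
  rewrite plus_Sl, <- plus_S, minus_plus; intro H; destruct (sc_neq0 H).
Qed.

Definition pow n : dom S N := prec params one (add v1 v1) n.

Lemma eval_pow2 V (e : env S V) (a : tm V N) : eval e (pow2 a) = pow (eval e a).
Proof. reflexivity. Qed.

Lemma pow_0 : pow (zero S) = sc (zero S).
Proof. apply prec_0. Qed.

Lemma pow_S n : pow (sc n) = plus (pow n) (pow n).
Proof. unfold pow; rewrite prec_S; reflexivity. Qed.

Lemma pow_pred n : sc (pre (pow n)) = pow n.
Proof.
  revert n; poly (Succ @ predN (pow2 v0) == pow2 v0).
  - now rewrite pow_0, pre_S.
  - intros n H; now rewrite pow_S, <- H, plus_S, pre_S.
Qed.

Lemma ifz_0 V (e : env S V) s (n : tm V N) (a b : tm V s) :
  eval e n = zero S -> eval e (ifz n a b) = eval e a.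
Proof. unfold ifz; rewrite eval_primrec; intros ->; apply prec_0. Qed.

Lemma ifz_S V (e : env S V) s (n : tm V N) (a b : tm V s) m :
  eval e n = sc m -> eval e (ifz n a b) = eval e b.
Proof. unfold ifz; rewrite eval_primrec; intros ->; now rewrite prec_S, !eval_wk. Qed.

Lemma pow_mono a b : le a b -> le (pow a) (pow b).
Proof.
  intros [c <-]; revert c.
  apply (induction_on (e := params)
    (A := Le (pow2 (Var (vs a))) (pow2 (Var (vs a) + v0)))); [simpl; tauto| | |].
  - intro n; rewrite sat_Le; reflexivity.
  - rewrite plus_0; apply le_refl.
  - intros n H; rewrite plus_S, pow_S; eapply le_trans; [exact H|apply le_plus].
Qed.

(** For a strictly increasing [f] with [f 0 = 0], the recursion in the
    hypotheses computes the largest [d] with [f d <= c].  Both the inverse of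
    pairing and integer division are instances. *)
Lemma largest_spec (f L : dom S ty1) :
  app f (zero S) = zero S ->
  (forall d, le (sc (app f d)) (app f (sc d))) ->
  app L (zero S) = zero S ->
  (forall c, le (app f (sc (app L c))) (sc c) -> app L (sc c) = sc (app L c)) ->
  (forall c, ~ le (app f (sc (app L c))) (sc c) -> app L (sc c) = app L c) ->
  forall c, le (app f (app L c)) c /\ le (sc c) (app f (sc (app L c))).
Proof.
  intros f0 fS L0 LS LN.
  apply (induction_on (e := params)
    (A := Le (Var (vs f) @ (Var (vs L) @ v0)) v0 &
          Lt v0 (Var (vs f) @ (Succ @ (Var (vs L) @ v0))))); [simpl; tauto| | |].
  - intro n; rewrite sat_And, sat_Le, sat_Lt; reflexivity.
  - rewrite L0, f0; split; [apply le_refl|]; rewrite <- f0 at 1; apply fS.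
  - intros c [H1 H2]; destruct (classic (le (app f (sc (app L c))) (sc c))) as [K|K].
    + rewrite (LS _ K); split; [exact K|].
      apply le_trans with (sc (app f (sc (app L c)))); [now apply le_SS|apply fS].
    + rewrite (LN _ K); split; [eapply le_trans; [exact H1|apply le_sc]|].
      now apply lt_iff.
Qed.

Definition triangle n : dom S N := prec params Zero (v1 + Succ @ v0) n.

Lemma triangle_0 : triangle (zero S) = zero S.
Proof. apply prec_0. Qed.

Lemma triangle_S n : triangle (sc n) = plus (triangle n) (sc n).
Proof. unfold triangle; rewrite prec_S; reflexivity. Qed.

Lemma triangle_mono a b : le a b -> le (triangle a) (triangle b).
Proof.
  intros [c <-]; revert c.
  apply (induction_on (e := params)
    (A := Le (tri (Var (vs a))) (tri (Var (vs a) + v0)))); [simpl; tauto| | |].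
  - intro n; rewrite sat_Le; reflexivity.
  - rewrite plus_0; apply le_refl.
  - intros n H; rewrite plus_S, triangle_S; eapply le_trans; [exact H|apply le_plus].
Qed.

Definition diagonal c : dom S N := eval params (diag (Var c)).

Lemma diagonal_spec c : le (triangle (diagonal c)) c /\ le (sc c) (triangle (sc (diagonal c))).
Proof.
  pose (step := ifz (tri (Succ @ v1) - Succ @ v0) (Succ @ v1) v1 : tm (ext (ext (dom S) N) N) N).
  assert (E : forall n, diagonal (sc n) =
    eval (econs (econs params (diagonal n)) n) step).
  { intro n; unfold diagonal, diag; rewrite !eval_primrec; apply prec_S. }
  assert (F : forall n, app (eval params (lam (tri v0))) n = triangle n)
    by (intro; now rewrite eval_lam).
  assert (G : forall n, app (eval params (lam (diag v0))) n = diagonal n)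
    by (intro; now rewrite eval_lam).
  assert (L := largest_spec (f := eval params (lam (tri v0)))
    (L := eval params (lam (diag v0)))).
  rewrite F, G in L.
  assert (C : forall n, eval (econs (econs params (diagonal n)) n) (tri (Succ @ v1) - Succ @ v0) =
    minus (triangle (sc (diagonal n))) (sc n)) by reflexivity.
  enough (H : le (app (eval params (lam (tri v0))) (app (eval params (lam (diag v0))) c)) c /\
    le (sc c) (app (eval params (lam (tri v0))) (sc (app (eval params (lam (diag v0))) c))))
    by (now rewrite G, !F in H).
  apply L; clear L; try (intros d; rewrite ?G, ?F).
  - apply triangle_0.
  - rewrite triangle_S, plus_S; apply le_SS, le_plus.
  - apply prec_0.
  - intro H; rewrite E; unfold step; rewrite ifz_0; [reflexivity|].
    rewrite C; now apply minus_eq0.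
  - intro H; rewrite E; unfold step.
    destruct (zero_or_succ (minus (triangle (sc (diagonal d))) (sc d))) as [K|[m K]].
    + now apply minus_eq0 in K.
    + erewrite ifz_S; [reflexivity|rewrite C; exact K].
Qed.

Definition npair a b : dom S N := plus (triangle (plus a b)) a.

Lemma eval_pairN V (e : env S V) (a b : tm V N) :
  eval e (pairN a b) = npair (eval e a) (eval e b).
Proof. reflexivity. Qed.

Lemma pair_mono a b c d : le a c -> le b d -> le (npair a b) (npair c d).
Proof.
  intros; apply le_plus2; trivial; now apply triangle_mono, le_plus2.
Qed.

(** Cantor's pairing lies between two consecutive triangular numbers. *)
Lemma diagonal_pair a b : diagonal (npair a b) = plus a b.
Proof.
  destruct (diagonal_spec (npair a b)) as [H1 H2].
  set (s := diagonal (npair a b)) in *.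
  assert (K1 : le (triangle (plus a b)) (npair a b)) by apply le_plus.
  assert (K2 : le (sc (npair a b)) (triangle (sc (plus a b)))).
  { unfold npair; rewrite triangle_S, plus_S; apply le_SS, le_plus2;
      [apply le_refl|apply le_plus]. }
  apply le_antisym; apply NNPP; intro H; apply lt_iff, triangle_mono in H.
  - exact (lt_irrefl (le_trans K2 (le_trans H H1))).
  - exact (lt_irrefl (le_trans H2 (le_trans H K1))).
Qed.

Definition nfst c : dom S N := eval params (pi1 (Var c)).
Definition nsnd c : dom S N := eval params (pi2 (Var c)).

Lemma eval_pi1 V (e : env S V) (a : tm V N) : eval e (pi1 a) = nfst (eval e a).
Proof. reflexivity. Qed.

Lemma eval_pi2 V (e : env S V) (a : tm V N) : eval e (pi2 a) = nsnd (eval e a).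
Proof. reflexivity. Qed.

Lemma fst_pair a b : nfst (npair a b) = a.
Proof.
  change (minus (npair a b) (triangle (diagonal (npair a b))) = a).
  rewrite diagonal_pair; apply minus_plus.
Qed.

Lemma snd_pair a b : nsnd (npair a b) = b.
Proof.
  change (minus (diagonal (npair a b)) (nfst (npair a b)) = b).
  rewrite fst_pair, diagonal_pair; apply minus_plus.
Qed.

(** The quotient [a / d], as the largest [q] with [q d <= a]. *)
Definition quotN V (a d : tm V N) : tm V N :=
  primrec a Zero
    (ifz ((Succ @ v1) * wk (wk d) - Succ @ v0) (Succ @ v1) v1).

Definition quotient a d : dom S N := eval params (quotN (Var a) (Var d)).

Lemma eval_quotN V (e : env S V) (a d : tm V N) :
  eval e (quotN a d) = quotient (eval e a) (eval e d).
Proof.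
  unfold quotient, quotN; rewrite !eval_primrec; apply prec_ext; [reflexivity|].
  intros p i.
  assert (C : forall U (f : env S U) (t : tm U N), eval f t = eval e d ->
    eval (econs (econs f p) i) ((Succ @ v1) * wk (wk t) - Succ @ v0) =
    minus (times (sc p) (eval e d)) (sc i)).
  { intros U f t <-; rewrite eval_monus, eval_mul, !eval_wk; reflexivity. }
  destruct (zero_or_succ (minus (times (sc p) (eval e d)) (sc i))) as [K|[m K]].
  - rewrite !ifz_0; [reflexivity| |]; rewrite C; trivial.
  - erewrite ifz_S by (rewrite C; [exact K|trivial]).
    erewrite ifz_S by (rewrite C; [exact K|trivial]); reflexivity.
Qed.

Lemma quotient_spec a d :
  le (times (quotient a (sc d)) (sc d)) a /\ le (sc a) (times (sc (quotient a (sc d))) (sc d)).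
Proof.
  pose (D := Var (vs (sc d)) : tm (ext (dom S) N) N).
  assert (F : forall n, app (eval params (lam (v0 * D))) n = times n (sc d))
    by (intro; rewrite eval_lam, eval_mul; reflexivity).
  assert (G : forall n, app (eval params (lam (quotN v0 D))) n = quotient n (sc d))
    by (intro; rewrite eval_lam, eval_quotN; reflexivity).
  assert (C : forall n p, eval (econs (econs params p) n)
    ((Succ @ v1) * wk (wk (Var (sc d))) - Succ @ v0) = minus (times (sc p) (sc d)) (sc n)).
  { intros; rewrite eval_monus, eval_mul, !eval_wk; reflexivity. }
  assert (E : forall n, quotient (sc n) (sc d) =
    eval (econs (econs params (quotient n (sc d))) n)
      (ifz ((Succ @ v1) * wk (wk (Var (sc d))) - Succ @ v0) (Succ @ v1) v1)).
  { intro n; unfold quotient at 1, quotN; rewrite eval_primrec; apply prec_S. }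
  enough (H : le (app (eval params (lam (v0 * D))) (app (eval params (lam (quotN v0 D))) a)) a /\
    le (sc a) (app (eval params (lam (v0 * D))) (sc (app (eval params (lam (quotN v0 D))) a))))
    by (now rewrite G, !F in H).
  apply largest_spec; try (intros n; rewrite ?G, ?F).
  - rewrite F; apply times_0l.
  - rewrite times_Sl, plus_S; apply le_SS, le_plus.
  - rewrite G; apply prec_0.
  - intro H; rewrite E, ifz_0; [reflexivity|].
    rewrite C; now apply minus_eq0.
  - intro H; rewrite E.
    destruct (zero_or_succ (minus (times (sc (quotient n (sc d))) (sc d)) (sc n))) as [K|[m K]].
    + now apply minus_eq0 in K.
    + erewrite ifz_S; [reflexivity|rewrite C; exact K].
Qed.
End Model.

#[global] Opaque plus times pre minus pow triangle diagonal npair nfst nsnd quotient.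
End ModelArithmetic.

Module Fractions.
Import Completeness all_boot all_order all_algebra boolp ring lra.
Import Order.TTheory GRing.Theory Num.Theory.
Local Open Scope ring_scope.
Set Implicit Arguments.
Unset Strict Implicit.

(** * The ordered field of fractions of an arithmetic *)

(** What is needed of the numbers of a model to form fractions: a cancellative
    semiring that is totally ordered by [exists c, a + c = b] and has no zero
    divisors, in which every nonzero number is a successor. *)
Record arith := Arith {
  num : Set;
  num0 : num;
  num1 : num;
  nadd : num -> num -> num;
  nmul : num -> num -> num;
  naddA : associative nadd;
  naddC : commutative nadd;
  nadd0 : left_id num0 nadd;
  naddI : forall a b c, nadd a c = nadd b c -> a = b;
  nadd_eq0 : forall a b, nadd a b = num0 -> b = num0;
  ntotal : forall a b, exists c, nadd a c = b \/ nadd b c = a;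
  nmulA : associative nmul;
  nmulC : commutative nmul;
  nmul1 : left_id num1 nmul;
  nmulD : left_distributive nmul nadd;
  nmul0 : left_zero num0 nmul;
  nmul_eq0 : forall a b, nmul a b = num0 -> a = num0 \/ b = num0;
  num_neq01 : num1 <> num0;
  npred : forall a, a <> num0 -> exists b, a = nadd b num1
}.

HB.instance Definition _ (A : arith) := gen_eqMixin (num A).
HB.instance Definition _ (A : arith) := gen_choiceMixin (num A).
HB.instance Definition _ (A : arith) :=
  GRing.isNmodule.Build (num A) (@naddA A) (@naddC A) (@nadd0 A).
HB.instance Definition _ (A : arith) :=
  GRing.Nmodule_isComPzSemiRing.Build (num A) (@nmulA A) (@nmulC A) (@nmul1 A)
    (@nmulD A) (@nmul0 A).

Section Carrier.
Variable A : arith.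
Implicit Types a b c p m d : num A.

Lemma num_addI a b c : a + c = b + c -> a = b.
Proof. exact: naddI. Qed.

Lemma num_add_eq0 a b : a + b = 0 -> b = 0.
Proof. exact: nadd_eq0. Qed.

Lemma num_mul_eq0 a b : a * b = 0 -> a = 0 \/ b = 0.
Proof. exact: nmul_eq0. Qed.

Lemma num_total a b : exists c, a + c = b \/ b + c = a.
Proof. exact: ntotal. Qed.

Lemma num_pred a : a <> 0 -> exists b, a = b + 1.
Proof. exact: npred. Qed.

Lemma num_succ_neq0 d : d + 1 <> 0.
Proof. by move/num_add_eq0; exact: num_neq01. Qed.

Lemma num_mulI a b d : a * (d + 1) = b * (d + 1) -> a = b.
Proof.
have cancel c e : c * (d + 1) = (c + e) * (d + 1) -> c = c + e.
  move=> H; suff -> : e = 0 by rewrite addr0.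
  case: (@num_mul_eq0 e (d + 1)) => //; last by move/num_succ_neq0.
  apply: (@num_addI _ _ (c * (d + 1))).
  by rewrite add0r {2}H; ring.
case: (num_total a b) => c [<- /cancel //|<- H].
by symmetry; apply: cancel.
Qed.

(** The triple [(p, m, d)] stands for [(p - m) / (d + 1)], as in the coding of
    rationals by [rat]. *)
Definition triple : Set := (num A * num A * num A)%type.

Definition same (x y : triple) : Prop :=
  let: (p, m, d) := x in let: (q, n, e) := y in
  p * (e + 1) + n * (d + 1) = q * (d + 1) + m * (e + 1).

Lemma same_refl x : same x x.
Proof. by case: x => [[p m] d] /=. Qed.

Lemma same_sym x y : same x y -> same y x.
Proof. by case: x y => [[p m] d] [[q n] e] /= H; rewrite H. Qed.

(** Multiplying the two hypotheses by the outer denominators and adding them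
    gives the conclusion up to a common term and the middle denominator. *)
Lemma same_trans x y z : same x y -> same y z -> same x z.
Proof.
case: x y z => [[p m] d] [[q n] e] [[r k] g] /= H K.
apply: (@num_mulI _ _ e); apply: (@num_addI _ _ (n * (d + 1) * (g + 1))).
transitivity ((p * (e + 1) + n * (d + 1)) * (g + 1) + k * (e + 1) * (d + 1)); first by ring.
rewrite H.
transitivity ((q * (g + 1) + k * (e + 1)) * (d + 1) + m * (e + 1) * (g + 1)); first by ring.
by rewrite K; ring.
Qed.

Definition frac : Set := quot same.
Definition fr (x : triple) : frac := class same_refl same_sym same_trans x.

Lemma frP x y : same x y <-> fr x = fr y.
Proof. exact: class_eq. Qed.

Lemma frac_ind (P : frac -> Prop) : (forall x, P (fr x)) -> forall u, P u.
Proof. by move=> H u; rewrite -(repK same_refl same_sym same_trans u). Qed.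

Lemma rep_fr x : same (rep (fr x)) x.
Proof. exact: rep_class. Qed.

Definition addt (x y : triple) : triple :=
  let: (p, m, d) := x in let: (q, n, e) := y in
  (p * (e + 1) + q * (d + 1), m * (e + 1) + n * (d + 1), d * e + d + e).
Definition mult (x y : triple) : triple :=
  let: (p, m, d) := x in let: (q, n, e) := y in
  (p * q + m * n, p * n + m * q, d * e + d + e).
Definition oppt (x : triple) : triple := let: (p, m, d) := x in (m, p, d).

Lemma addtC x y : addt x y = addt y x.
Proof. by case: x y => [[p m] d] [[q n] e] /=; do 2 (congr pair; try ring). Qed.

Lemma multC x y : mult x y = mult y x.
Proof. by case: x y => [[p m] d] [[q n] e] /=; do 2 (congr pair; try ring). Qed.

Lemma same_addt x y z : same x y -> same (addt x z) (addt y z).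
Proof.
case: x y z => [[p m] d] [[q n] e] [[r k] g] /= H.
transitivity ((p * (e + 1) + n * (d + 1)) * (g + 1) * (g + 1) +
  (r + k) * (d + 1) * (e + 1) * (g + 1)); first by ring.
by rewrite H; ring.
Qed.

Lemma same_mult x y z : same x y -> same (mult x z) (mult y z).
Proof.
case: x y z => [[p m] d] [[q n] e] [[r k] g] /= H.
transitivity ((p * (e + 1) + n * (d + 1)) * r * (g + 1) +
  (q * (d + 1) + m * (e + 1)) * k * (g + 1)); first by ring.
by rewrite H -{2}H; ring.
Qed.

Lemma same_oppt x y : same x y -> same (oppt x) (oppt y).
Proof.
by case: x y => [[p m] d] [[q n] e] /= H; rewrite addrC -H addrC.
Qed.

Definition addf (u v : frac) : frac := fr (addt (rep u) (rep v)).
Definition mulf (u v : frac) : frac := fr (mult (rep u) (rep v)).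
Definition oppf (u : frac) : frac := fr (oppt (rep u)).

Lemma addfE x y : addf (fr x) (fr y) = fr (addt x y).
Proof.
apply/frP; apply: same_trans (same_addt y (rep_fr x)).
by rewrite addtC [addt _ y]addtC; apply/same_addt/rep_fr.
Qed.

Lemma mulfE x y : mulf (fr x) (fr y) = fr (mult x y).
Proof.
apply/frP; apply: same_trans (same_mult y (rep_fr x)).
by rewrite multC [mult _ y]multC; apply/same_mult/rep_fr.
Qed.

Lemma oppfE x : oppf (fr x) = fr (oppt x).
Proof. by apply/frP/same_oppt/rep_fr. Qed.

Definition zerof := fr (0, 0, 0).
Definition onef := fr (1, 0, 0).

Ltac fracs := repeat (let x := fresh "x" in let d := fresh "d" in
  elim/frac_ind => -[x d]; let p := fresh "p" in let m := fresh "m" in case: x => [p m]).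

Lemma addfA : associative addf.
Proof. fracs; rewrite !addfE; apply/frP => /=; ring. Qed.
Lemma addfC : commutative addf.
Proof. fracs; rewrite !addfE; apply/frP => /=; ring. Qed.
Lemma add0f : left_id zerof addf.
Proof. fracs; rewrite !addfE; apply/frP => /=; ring. Qed.
Lemma addNf : left_inverse zerof oppf addf.
Proof. fracs; rewrite oppfE !addfE; apply/frP => /=; ring. Qed.
Lemma mulfA : associative mulf.
Proof. fracs; rewrite !mulfE; apply/frP => /=; ring. Qed.
Lemma mulfC : commutative mulf.
Proof. fracs; rewrite !mulfE; apply/frP => /=; ring. Qed.
Lemma mul1f : left_id onef mulf.
Proof. fracs; rewrite !mulfE; apply/frP => /=; ring. Qed.
Lemma mulfDl : left_distributive mulf addf.
Proof. fracs; rewrite ?(mulfE, addfE); apply/frP => /=; ring. Qed.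

Lemma fr_eq0 p m d : fr (p, m, d) = zerof <-> p = m.
Proof.
split=> [/frP /= H|->]; last by apply/frP => /=; ring.
by apply: (@num_mulI _ _ 0); transitivity (p * (0 + 1) + 0 * (d + 1)); [ring|rewrite H; ring].
Qed.

(** The case distinction on the order of [p] and [m] gives [p - m], unless
    it is zero, the form [b + 1] or [- (b + 1)], and [b + 1] is a denominator. *)
Lemma invf_exists (u : frac) : exists v, u <> zerof -> mulf v u = onef.
Proof.
elim/frac_ind: u => -[[p m] d].
have [c [E|E]] := num_total p m; have [c0|/num_pred H] := pselect (c = 0).
- by exists zerof => -[]; apply/fr_eq0; rewrite -E c0 addr0.
- have [b cb] := H; exists (fr (0, d + 1, b)) => _; rewrite mulfE; apply/frP => /=.
  by rewrite -E cb; ring.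
- by exists zerof => -[]; apply/fr_eq0; rewrite -E c0 addr0.
- have [b cb] := H; exists (fr (d + 1, 0, b)) => _; rewrite mulfE; apply/frP => /=.
  by rewrite -E cb; ring.
Qed.

Definition invf (u : frac) : frac :=
  if pselect (u = zerof) then zerof else projT1 (cid (invf_exists u)).

Lemma mulVf u : u <> zerof -> mulf (invf u) u = onef.
Proof.
move=> H; rewrite /invf; case: pselect => [/H|K] //; by case: cid => v /= /(_ K).
Qed.

Lemma invf0 : invf zerof = zerof.
Proof. by rewrite /invf; case: pselect. Qed.

Lemma onef_neq0 : onef <> zerof.
Proof. by move/fr_eq0; exact: num_neq01. Qed.

Definition nle a b : Prop := exists c, a + c = b.

Lemma nle_total a b : nle a b \/ nle b a.
Proof. by case: (num_total a b) => c [H|H]; [left|right]; exists c. Qed.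

Lemma nle_add a b c d : nle a b -> nle c d -> nle (a + c) (b + d).
Proof. by move=> [x <-] [y <-]; exists (x + y); ring. Qed.

Lemma nle_anti a b : nle a b -> nle b a -> a = b.
Proof.
move=> [x <-] [y H].
have E : x + y = 0 by apply: (@num_addI _ _ a); rewrite add0r addrC addrA.
by rewrite addrC in E; rewrite (num_add_eq0 E) addr0.
Qed.

Lemma nle_mulr a b c : nle a b -> nle (a * c) (b * c).
Proof. by move=> [x <-]; exists (x * c); ring. Qed.

Lemma nle_addr2 a b c : nle (a + c) (b + c) -> nle a b.
Proof. by move=> [x H]; exists x; apply: (@num_addI _ _ c); rewrite -H; ring. Qed.

Lemma nle_mulr2 a b d : nle (a * (d + 1)) (b * (d + 1)) -> nle a b.
Proof.
move=> H; case: (nle_total a b) => // /(nle_mulr (d + 1)) K.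
by exists 0; rewrite addr0; apply: num_mulI (nle_anti H K).
Qed.

Definition triple_le (x y : triple) : Prop :=
  let: (p, m, d) := x in let: (q, n, e) := y in
  nle (p * (e + 1) + n * (d + 1)) (q * (d + 1) + m * (e + 1)).

Lemma triple_le_same x y z : same x y -> triple_le y z -> triple_le x z.
Proof.
case: x y z => [[p m] d] [[q n] e] [[r k] g] /= H K.
apply: (@nle_mulr2 _ _ e); apply: (@nle_addr2 _ _ (n * (d + 1) * (g + 1))).
have := nle_add (nle_mulr (d + 1) K)
  (ex_intro (fun c => m * (e + 1) * (g + 1) + c = _) 0 (addr0 _)).
congr nle; last by ring.
transitivity ((q * (d + 1) + m * (e + 1)) * (g + 1) + k * (e + 1) * (d + 1)); first by ring.
by rewrite -H; ring.
Qed.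

Lemma triple_le_opp x y : triple_le x y <-> triple_le (oppt y) (oppt x).
Proof. by case: x y => [[p m] d] [[q n] e] /=; rewrite addrC [q * _ + _]addrC. Qed.

Lemma triple_le_same_r x y z : same x y -> triple_le z y -> triple_le z x.
Proof. by move=> /same_oppt H /triple_le_opp K; apply/triple_le_opp/(triple_le_same H K). Qed.

Definition lef (u v : frac) : bool := `[< triple_le (rep u) (rep v) >].

Lemma lefE x y : lef (fr x) (fr y) <-> triple_le x y.
Proof.
rewrite /lef asboolE; split=> H.
  by apply: triple_le_same (same_sym (rep_fr x)) _; apply: triple_le_same_r (same_sym (rep_fr y)) H.
by apply: triple_le_same (rep_fr x) _; apply: triple_le_same_r (rep_fr y) H.
Qed.

End Carrier.

HB.instance Definition _ (A : arith) := gen_eqMixin (frac A).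
HB.instance Definition _ (A : arith) := gen_choiceMixin (frac A).
HB.instance Definition _ (A : arith) :=
  GRing.isZmodule.Build (frac A) (@addfA A) (@addfC A) (@add0f A) (@addNf A).

Fact onef_neq0b (A : arith) : onef A != 0 :> frac A.
Proof. apply/eqP; exact: onef_neq0. Qed.

HB.instance Definition _ (A : arith) :=
  GRing.Zmodule_isComNzRing.Build (frac A) (@mulfA A) (@mulfC A) (@mul1f A)
    (@mulfDl A) (@onef_neq0b A).

Fact mulVfb (A : arith) (u : frac A) : u != 0 -> invf u * u = 1.
Proof. by move/eqP/mulVf. Qed.

HB.instance Definition _ (A : arith) :=
  GRing.ComNzRing_isField.Build (frac A) (@mulVfb A) (@invf0 A).

Section Order.
Variable A : arith.
Implicit Types u v : frac A.

Ltac fracs := repeat (let x := fresh "x" in let d := fresh "d" in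
  elim/frac_ind => -[x d]; let p := fresh "p" in let m := fresh "m" in case: x => [p m]).

Lemma fr_ge0 (p m d : num A) : lef 0 (fr (p, m, d)) <-> nle m p.
Proof.
rewrite -[0]/(fr (0, 0, 0)) lefE /=; split=> [[c H]|[c <-]].
  by exists c; transitivity (0 * (d + 1) + m * (0 + 1) + c); [ring|rewrite H; ring].
by exists c; ring.
Qed.

Lemma fr_le0 (p m d : num A) : lef (fr (p, m, d)) 0 <-> nle p m.
Proof.
rewrite -[0]/(fr (0, 0, 0)) lefE /=; split=> [[c H]|[c <-]].
  by exists c; transitivity (p * (0 + 1) + 0 * (d + 1) + c); [ring|rewrite H; ring].
by exists c; ring.
Qed.

Lemma frD x y : fr x + fr y = fr (addt x y) :> frac A.
Proof. exact: addfE. Qed.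
Lemma frM x y : fr x * fr y = fr (mult x y) :> frac A.
Proof. exact: mulfE. Qed.
Lemma frN x : - fr x = fr (oppt x) :> frac A.
Proof. exact: oppfE. Qed.

Fact lef_add u v : lef 0 u -> lef 0 v -> lef 0 (u + v).
Proof.
move: u v; fracs; rewrite frD !fr_ge0 => H K.
by apply: nle_add; apply: nle_mulr.
Qed.

Fact lef_mul u v : lef 0 u -> lef 0 v -> lef 0 (u * v).
Proof.
move: u v; fracs; rewrite frM !fr_ge0 => -[c <-] [b <-].
by exists (c * b); ring.
Qed.

Fact lef_anti u : lef 0 u -> lef u 0 -> u = 0.
Proof.
by move: u; fracs; rewrite fr_ge0 fr_le0 => H K; apply/fr_eq0/nle_anti.
Qed.

Fact lef_sub u v : lef 0 (v - u) = lef u v.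
Proof.
move: u v; fracs; apply/idP/idP; rewrite frN frD fr_ge0 lefE /=; 
  by congr nle; ring.
Qed.

Fact lef_total u : lef 0 u || lef u 0.
Proof.
move: u; fracs; have [H|H] := nle_total m p; apply/orP; [left|right].
  exact/fr_ge0.
exact/fr_le0.
Qed.

Definition normf u : frac A := if lef 0 u then u else - u.

Fact normfN u : normf (- u) = normf u.
Proof.
have E : lef 0 (- u) = lef u 0 by rewrite -[RHS]lef_sub sub0r.
rewrite /normf E opprK.
have [H|H] := boolP (lef 0 u); have [K|K] := boolP (lef u 0) => //.
  by rewrite (lef_anti H K) oppr0.
by have := lef_total u; rewrite (negPf H) (negPf K).
Qed.

Fact ge0_normf u : lef 0 u -> normf u = u.
Proof. by rewrite /normf => ->. Qed.

Definition ltf u v : bool := (v != u) && lef u v.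

Fact ltf_def u v : ltf u v = (v != u) && lef u v.
Proof. by []. Qed.
End Order.

HB.instance Definition _ (A : arith) :=
  Num.IntegralDomain_isLeReal.Build (frac A) (@lef_add A) (@lef_mul A) (@lef_anti A)
    (@lef_sub A) (@lef_total A) (@normfN A) (@ge0_normf A) (@ltf_def A).

Section Embedding.
Variable A : arith.
Implicit Types a b p m d : num A.

Definition emb a : frac A := fr (a, 0, 0).

Lemma embD a b : emb (a + b) = emb a + emb b.
Proof. by rewrite frD; apply/frP => /=; ring. Qed.

Lemma embM a b : emb (a * b) = emb a * emb b.
Proof. by rewrite frM; apply/frP => /=; ring. Qed.

Lemma emb_le a b : emb a <= emb b <-> nle a b.
Proof.
rewrite -[_ <= _]/(lef _ _) lefE /=.
by split=> -[c H]; exists c; move: H; rewrite !(mul0r, add0r, mulr1, addr0).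
Qed.

End Embedding.
End Fractions.

Module OpenSets.
Import all_boot all_order all_algebra boolp ring lra.
Import -(notations) Defs.
Import Completeness ModelArithmetic Fractions.
Import Order.TTheory GRing.Theory Num.Theory.
Local Open Scope ring_scope.
Set Implicit Arguments.
Unset Strict Implicit.
Unset Printing Implicit Defensive.

(** * Rationals and reals in a model *)

Section Model.
Variables (S : structure) (HS : model S).
Local Notation num := (dom S N).
Local Notation seq := (dom S (Arr N N)).
Implicit Types (n i k q : num) (x y : seq).
Implicit Types V : vars.

Fact sc_pred n : n <> zero S -> exists m, n = plus m (sc (zero S)).
Proof.
case: (zero_or_succ HS n) => [//|[m ->]] _; exists m.
by rewrite plus_S // plus_0.
Qed.

Fact plus_eq0r a b : plus a b = zero S -> b = zero S.
Proof. exact: plus_eq0. Qed.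

Fact mul1n n : times (sc (zero S)) n = n.
Proof. by rewrite timesC // times_1. Qed.

Fact timesDl (a b c : num) : times (plus a b) c = plus (times a c) (times b c).
Proof. by rewrite timesC // timesDr // !(timesC HS c). Qed.

Definition model_arith : arith := @Arith num (zero S) (sc (zero S)) (@plus S) (@times S)
  (plusA HS) (plusC HS) (plus_0l HS) (plusI HS) plus_eq0r (plus_total HS) (timesA HS)
  (timesC HS) mul1n timesDl (times_0l HS) (@times_eq0 _ HS) (@sc_neq0 _ HS (zero S)) sc_pred.

(** The field of fractions enters only through these properties.  Keeping it
    abstract also keeps its construction out of the computations below. *)
Record embedding (R : realFieldType) (emb : num -> R) : Prop := {
  embedding_add : forall a b, emb (plus a b) = emb a + emb b;
  embedding_mul : forall a b, emb (times a b) = emb a * emb b;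
  embedding_le : forall a b, emb a <= emb b <-> le a b;
  embedding_1 : emb (sc (zero S)) = 1
}.

Lemma embedding_exists : exists (R : realFieldType) (emb : num -> R), embedding emb.
Proof.
exists (frac model_arith), (@Fractions.emb model_arith); split=> //.
- exact: (@embD model_arith).
- exact: (@embM model_arith).
- exact: (@Fractions.emb_le model_arith).
Qed.

Section Values.
Variables (F : realFieldType) (emb : num -> F) (Hemb : embedding emb).

Let emb_add := embedding_add Hemb.
Let emb_mul := embedding_mul Hemb.
Let emb_le := embedding_le Hemb.
Let emb1 := embedding_1 Hemb.

Lemma emb0 : emb (zero S) = 0.
Proof. by apply: (addrI (emb (zero S))); rewrite -emb_add plus_0 // addr0. Qed.

Lemma emb_sc n : emb (sc n) = emb n + 1.
Proof. by rewrite -emb1 -emb_add plus_S // plus_0. Qed.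

Lemma emb_ge0 n : 0 <= emb n.
Proof. by rewrite -emb0; apply/emb_le/le_0. Qed.

Lemma emb_sc_gt0 n : 0 < emb (sc n).
Proof. by rewrite emb_sc; have := emb_ge0 n; lra. Qed.

Lemma times_pred (a b : num) : sc (pre (times (sc a) (sc b))) = times (sc a) (sc b).
Proof. by rewrite times_S // plus_S // pre_S. Qed.

Lemma emb_minus (a b : num) : emb (minus a b) = Num.max (emb a - emb b) 0.
Proof.
have [/[dup] H [c <-]|/[dup] H [c <-]] := le_or_lt HS a b.
  rewrite minus_plus_eq0 // emb_add emb0 max_r //.
  by have := emb_ge0 c; lra.
rewrite plus_Sl // -plus_S // minus_plus // emb_add max_l; first by lra.
by have := emb_ge0 (sc c); lra.
Qed.

Definition val q : F := (emb (nfst (nfst q)) - emb (nsnd (nfst q))) / emb (sc (nsnd q)).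

Lemma val_rat p m d : val (npair (npair p m) d) = (emb p - emb m) / emb (sc d).
Proof. by rewrite /val !(fst_pair, snd_pair). Qed.

Section Terms.
Variables (V : vars) (e : env S V).

Lemma eval_rat (p m d : tm V N) :
  eval e (rat p m d) = npair (npair (eval e p) (eval e m)) (eval e d).
Proof. by rewrite !eval_pairN. Qed.

Lemma eval_rpos (q : tm V N) : eval e (rpos q) = nfst (nfst (eval e q)).
Proof. by rewrite !eval_pi1. Qed.
Lemma eval_rneg (q : tm V N) : eval e (rneg q) = nsnd (nfst (eval e q)).
Proof. by rewrite eval_pi2 eval_pi1. Qed.
Lemma eval_rden (q : tm V N) : eval e (rden q) = sc (nsnd (eval e q)).
Proof. by rewrite -eval_pi2. Qed.

Definition evalE := (eval_rat, eval_rpos, eval_rneg, eval_rden, eval_add, eval_monus,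
  eval_predN, eval_pow2, eval_pi2).

Lemma val_sub (a b : tm V N) : val (eval e (subQ a b)) = val (eval e a) - val (eval e b).
Proof.
rewrite /subQ eval_rat val_rat eval_predN !eval_add !(eval_mul HS) !evalE.
rewrite times_pred.
have := emb_sc_gt0 (nsnd (eval e a)); have := emb_sc_gt0 (nsnd (eval e b)).
rewrite !emb_add !emb_mul /val.
by move=> /lt0r_neq0 ? /lt0r_neq0 ?; field; apply/andP.
Qed.

Lemma val_abs (a : tm V N) : val (eval e (absQ a)) = `|val (eval e a)|.
Proof.
rewrite /absQ eval_rat val_rat !evalE emb_add.
set a1 := nfst (nfst _); set a2 := nsnd (nfst _).
rewrite (emb_minus a1 a2) (emb_minus a2 a1) emb0 subr0 /val -/a1 -/a2.
rewrite normf_div [`|emb (sc _)|]gtr0_norm ?emb_sc_gt0 //; congr (_ / _).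
have [H|H] := lerP 0 (emb a1 - emb a2).
  by rewrite max_r ?ger0_norm ?addr0 //; lra.
by rewrite add0r max_l ?ltr0_norm //; lra.
Qed.

Lemma sat_LeQ (a b : tm V N) : sat e (LeQ a b) <-> val (eval e a) <= val (eval e b).
Proof.
rewrite sat_Le // !eval_add !(eval_mul HS) !evalE -emb_le !emb_add !emb_mul /val.
by rewrite ler_pdivrMr ?emb_sc_gt0 // mulrAC ler_pdivlMr ?emb_sc_gt0 //; split=> H; lra.
Qed.

Lemma sat_LtQ (a b : tm V N) : sat e (LtQ a b) <-> val (eval e a) < val (eval e b).
Proof.
rewrite sat_Lt // lt_iff // !eval_add !(eval_mul HS) !evalE -emb_le !emb_add !emb_mul /val.
rewrite ltr_pdivrMr ?emb_sc_gt0 // mulrAC ltr_pdivlMr ?emb_sc_gt0 // ltNge.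
by split=> [H|/negP H]; [apply/negP|] => K; apply: H; lra.
Qed.

End Terms.

(** The value [2^-n] of the code [eps n]. *)
Definition epsilon n : F := (emb (pow n))^-1.

Lemma pow_gt0 n : 0 < emb (pow n).
Proof. by rewrite -pow_pred // emb_sc_gt0. Qed.

Lemma epsilon_gt0 n : 0 < epsilon n.
Proof. by rewrite invr_gt0 pow_gt0. Qed.

Lemma epsilon_sc n : epsilon n = 2 * epsilon (sc n).
Proof.
rewrite /epsilon pow_S // emb_add.
by have H := pow_gt0 n; field; rewrite gt_eqF //=; rewrite ?gt_eqF //; lra.
Qed.

Lemma epsilon0 : epsilon (zero S) = 1.
Proof. by rewrite /epsilon pow_0 // emb1 invr1. Qed.

Lemma epsilon_plus n i : epsilon (plus n i) <= epsilon n.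
Proof.
rewrite lef_pV2 ?posrE ?pow_gt0 //; apply/emb_le/pow_mono => //; exact: le_plus.
Qed.

Lemma val_eps V (e : env S V) (t : tm V N) : val (eval e (eps t)) = epsilon (eval e t).
Proof. by rewrite eval_rat val_rat eval_predN eval_pow2 pow_pred // emb1 emb0 subr0 mul1r. Qed.

Lemma val_eps2 V (e : env S V) (t : tm V N) : val (eval e (eps2 t)) = 2 * epsilon (eval e t).
Proof.
rewrite eval_rat val_rat eval_predN eval_pow2 pow_pred // emb0 subr0; congr (_ * _).
by rewrite emb_sc emb1.
Qed.

Lemma eval_app V (e : env S V) s t (f : tm V (Arr s t)) a :
  eval e (App f a) = app (eval e f) (eval e a).
Proof. by []. Qed.

(** ** Real numbers *)

(** Reals are considered as sequences of values.  The constants are those of the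
    syntactic definitions; in particular [near] is the test at one index whose
    conjunction over all indices, or over the standard ones, is equality or
    infinite closeness. *)
Implicit Types f g h : num -> F.

Definition is_real f : Prop := forall n i, `|f n - f (plus n i)| < epsilon n.
Definition near f g n : Prop := `|f n - g n| <= 2 * epsilon n.
Definition eqr f g : Prop := forall n, near f g n.
Definition approx f g : Prop := forall n, std n -> near f g n.
Definition ltr f g : Prop := exists n, 2 * epsilon n < g n - f n.
Definition zeror : num -> F := fun _ => 0.
Definition dist f g : num -> F := fun n => `|f (sc n) - g (sc n)|.

(** A form of the Cauchy condition that does not depend on the order of the
    indices. *)
Lemma real_near f m n : is_real f -> `|f m - f n| < epsilon m + epsilon n.
Proof.
move=> Hf; have := epsilon_gt0 m; have := epsilon_gt0 n.
have [i [<-|<-]] := plus_total HS m n.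
  by have := Hf m i; lra.
by rewrite distrC; have := Hf n i; lra.
Qed.

Lemma real_shift f : is_real f -> is_real (f \o @sc S).
Proof.
move=> Hf n i; have := Hf (sc n) i; rewrite plus_Sl // (epsilon_sc n).
by have := epsilon_gt0 (sc n) => /=; lra.
Qed.

Lemma eqr_shift f : is_real f -> eqr f (f \o @sc S).
Proof.
move=> Hf n; have := real_near n (sc n) Hf; rewrite /near /= (epsilon_sc n).
by have := epsilon_gt0 (sc n); lra.
Qed.

(** The sequence [g] reads [f] two places ahead and rounds with an eighth of the
    precision, which leaves it a real and close to [f]. *)
Section Rounding.
Variables (f g : num -> F) (Hf : is_real f).
Hypothesis Hg : forall n, `|g n - f (sc (sc n))| < epsilon (sc (sc (sc n))).

Lemma real_rounding : is_real g.
Proof.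
move=> n i; move: (Hf (sc (sc n)) i) (Hg n) (Hg (plus n i)) (epsilon_plus n i).
rewrite !plus_Sl // !ltr_norml.
rewrite (epsilon_sc n) (epsilon_sc (sc n)) (epsilon_sc (sc (sc n))).
rewrite (epsilon_sc (plus n i)) (epsilon_sc (sc (plus n i))) (epsilon_sc (sc (sc (plus n i)))).
have := epsilon_gt0 (sc (sc (sc n))).
move=> ? /andP[? ?] /andP[? ?] /andP[? ?] ?; apply/andP; split; lra.
Qed.

Lemma rounding_near n : `|f n - g n| < 3 / 2 * epsilon n.
Proof.
move: (real_near n (sc (sc n)) Hf) (Hg n); rewrite !ltr_norml.
rewrite (epsilon_sc n) (epsilon_sc (sc n)) (epsilon_sc (sc (sc n))).
have := epsilon_gt0 (sc (sc (sc n))).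
move=> ? /andP[? ?] /andP[? ?]; apply/andP; split; lra.
Qed.

End Rounding.

(** Since [r] is positive and not infinitesimal, some standard [n] has
    [r n > 2 epsilon n].  Three places further, at [m], the error bounds have
    shrunk to an eighth, so that [r m > 7 epsilon m] while
    [h m < 2 epsilon m]; the index [m] witnesses both claims. *)
Lemma ltr_of_infinitesimal (r : num -> F) h : (forall n, std n -> std (sc n)) ->
  is_real r -> ltr zeror r -> ~ approx r zeror ->
  (forall n, std n -> h n < 2 * epsilon n) -> (forall n, 0 <= h n) ->
  ltr h r /\ ~ approx r h.
Proof.
move=> stS Hr [n0 H0] Hna Hh h0.
have [n sn Hn] : exists2 n, std n & 2 * epsilon n < `|r n|.
  apply: contrapT => K; apply: Hna => n sn; rewrite /near /zeror subr0 leNgt.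
  by apply/negP => L; apply: K; exists n.
have Hpos : 2 * epsilon n < r n.
  move: (real_near n n0 Hr) Hn H0; rewrite ltr_norml /zeror => /andP[? ?].
  have := epsilon_gt0 n; have := epsilon_gt0 n0.
  by case: (ger0P (r n)); lra.
pose m := sc (sc (sc n)).
have sm : std m by do 3 apply stS.
have Hm : 2 * epsilon m < r m - h m.
  move: (real_near n m Hr) (Hh m sm); rewrite ltr_norml => /andP[? ?] ?.
  have E : epsilon n = 8 * epsilon m.
    by rewrite (epsilon_sc n) (epsilon_sc (sc n)) (epsilon_sc (sc (sc n))) -/m; lra.
  by have := epsilon_gt0 m; lra.
split; first by exists m.
by move=> /(_ m sm); rewrite /near ler_norml => /andP[_]; lra.
Qed.

(** The errors add up to [epsilon n] for [f n] and half of it for [g (n + 1)];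
    the distance of the reals is at most the remaining half.  The strict
    inequality in [ltr], with its margin of [2 epsilon m], absorbs the errors at
    the auxiliary index [M] where [f] and [g] are compared. *)
Lemma near_shift f g (r : num -> F) n : is_real f -> is_real g ->
  (forall m, r m <= epsilon (sc n)) -> ltr (dist f g) r -> near f (g \o @sc S) n.
Proof.
move=> Hf Hg Hr [m]; rewrite /dist => Hm; pose M := sc (sc m).
move: Hm (Hr m) (real_near n M Hf) (real_near (sc m) M Hf) (real_near (sc m) M Hg)
  (real_near (sc n) M Hg); rewrite /near /=.
have := epsilon_gt0 M.
rewrite (epsilon_sc n) (epsilon_sc m) (epsilon_sc (sc m)) -/M !ltr_norml ler_norml.
case: (ger0P (f (sc m) - g (sc m))) => ? ? ? ? /andP[? ?] /andP[? ?] /andP[? ?] /andP[? ?];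
  apply/andP; split; lra.
Qed.

(** ** Evaluation of formulas on reals *)

Definition term (x : seq) n : F := val (app x n).

Lemma sat_All V (e : env S V) s A : sat e (All s A) <-> forall d, sat (econs e d) A.
Proof. by []. Qed.

Lemma sat_AllSt V (e : env S V) s A :
  sat e (AllSt s A) <-> forall d, std d -> sat (econs e d) A.
Proof. by []. Qed.

Section RealFormulas.
Variables (V : vars) (e : env S V).
Implicit Types s t : tm V (Arr N N).

Lemma sat_IsReal t : sat e (IsReal t) <-> is_real (term (eval e t)).
Proof.
split=> [/sat_All H n i|H].
  move/sat_All: (H n) => /(_ i).
  by rewrite sat_LtQ val_abs val_sub val_eps; cbn [eval]; rewrite !eval_wk eval_add.
apply/sat_All=> n; apply/sat_All=> i.
rewrite sat_LtQ val_abs val_sub val_eps; cbn [eval]; rewrite !eval_wk eval_add.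
exact: H.
Qed.

Lemma sat_close s t (n : tm V N) :
  sat e (close s t n) <-> near (term (eval e s)) (term (eval e t)) (eval e n).
Proof. by rewrite sat_LeQ val_abs val_sub val_eps2 !eval_app. Qed.

End RealFormulas.

Section SequenceFormulas.
Variables (V : vars) (e : env S V).
Implicit Types s t : tm V (Arr N N).

Lemma sat_EqR s t : sat e (EqR s t) <-> eqr (term (eval e s)) (term (eval e t)).
Proof.
split=> [/sat_All H n|H]; [move: (H n)|apply/sat_All => n];
  by rewrite sat_close !eval_wk => //; apply: H.
Qed.

Lemma sat_Approx s t : sat e (Approx s t) <-> approx (term (eval e s)) (term (eval e t)).
Proof.
split=> [/sat_AllSt H n /H|H]; last apply/sat_AllSt => n /H;
  by rewrite sat_close !eval_wk.
Qed.

Lemma sat_LtR s t : sat e (LtR s t) <-> ltr (term (eval e s)) (term (eval e t)).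
Proof.
rewrite sat_Ex; split=> -[n H]; exists n; move: H;
  by rewrite sat_LtQ val_sub val_eps2 !eval_app !eval_wk.
Qed.

Lemma sat_LtLtR s t : sat e (LtLtR s t) <->
  ltr (term (eval e s)) (term (eval e t)) /\ ~ approx (term (eval e t)) (term (eval e s)).
Proof. by rewrite sat_And sat_LtR -sat_Approx. Qed.

Lemma term_zeroR : term (eval e zeroR) = zeror.
Proof. by apply/funext => n; rewrite /term eval_lam // eval_rat val_rat subrr mul0r. Qed.

Lemma term_distR s t : term (eval e (distR s t)) = dist (term (eval e s)) (term (eval e t)).
Proof.
apply/funext => n.
by rewrite /term eval_lam // val_abs val_sub; cbn [eval]; rewrite !eval_wk.
Qed.
End SequenceFormulas.


(** ** Rounding *)

(** The multiple of [2^-n] obtained from [q] by truncation towards zero.  One of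
    the two quotients is zero, the subtractions being truncated. *)
Definition roundQ V (q n : tm V N) : tm V N :=
  rat (quotN (mul (monus (rpos q) (rneg q)) (pow2 n)) (rden q))
      (quotN (mul (monus (rneg q) (rpos q)) (pow2 n)) (rden q)) (predN (pow2 n)).

Lemma quotient_bounds (a d : num) :
  emb (quotient a (sc d)) * emb (sc d) <= emb a < (emb (quotient a (sc d)) + 1) * emb (sc d).
Proof.
have [H1 H2] := quotient_spec HS a d; apply/andP; split.
  by rewrite -emb_mul; apply/emb_le.
rewrite -emb_sc -emb_mul ltNge; apply/negP => /emb_le.
by apply/lt_iff.
Qed.

(** The integer part of [2^n (p - m) / (d + 1)], or zero if [p < m]. *)
Definition floor_scaled (p m d n : num) : num := quotient (times (minus p m) (pow n)) (sc d).

Lemma floor_scaled_bounds (p m d n : num) :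
  emb (floor_scaled p m d n) * epsilon n <= emb (minus p m) / emb (sc d) <
  (emb (floor_scaled p m d n) + 1) * epsilon n.
Proof.
have /andP[H1 H2] := quotient_bounds (times (minus p m) (pow n)) d.
rewrite emb_mul -/(floor_scaled p m d n) in H1 H2.
rewrite /epsilon ler_pdivlMr ?emb_sc_gt0 // mulrAC ler_pdivrMr ?pow_gt0 // H1 /=.
by rewrite ltr_pdivrMr ?emb_sc_gt0 // mulrAC ltr_pdivlMr ?pow_gt0.
Qed.

Section RoundingTerm.
Variables (V : vars) (e : env S V).

Lemma eval_roundQ (q n : tm V N) (p := nfst (nfst (eval e q))) (m := nsnd (nfst (eval e q)))
    (d := nsnd (eval e q)) (k := eval e n) :
  eval e (roundQ q n) = npair (npair (floor_scaled p m d k) (floor_scaled m p d k)) (pre (pow k)).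
Proof.
rewrite eval_rat !(eval_quotN HS) !(eval_mul HS).
rewrite (eval_monus e (rpos q) (rneg q)) (eval_monus e (rneg q) (rpos q)).
by rewrite eval_rden eval_rpos eval_rneg eval_predN eval_pow2.
Qed.

Lemma val_roundQ (q n : tm V N) :
  `|val (eval e (roundQ q n)) - val (eval e q)| < epsilon (eval e n).
Proof.
rewrite eval_roundQ val_rat pow_pred // /val.
set p := nfst (nfst _); set m := nsnd (nfst _); set d := nsnd _; set k := eval e n.
have /andP[H1 H2] := floor_scaled_bounds p m d k; have /andP[K1 K2] := floor_scaled_bounds m p d k.
have E : (emb p - emb m) / emb (sc d) =
    emb (minus p m) / emb (sc d) - emb (minus m p) / emb (sc d).
  rewrite -mulrBl (emb_minus p m) (emb_minus m p); congr (_ / _).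
  by have [H|H] := lerP (emb p - emb m) 0; [rewrite max_l|rewrite max_r]; lra.
rewrite E -/(epsilon k) ltr_norml; apply/andP; split; lra.
Qed.
End RoundingTerm.

Definition three V (n : tm V N) : tm V N := App Succ (App Succ (App Succ n)).

Definition roundR V (y : tm V (Arr N N)) : tm V (Arr N N) :=
  lam (roundQ (App (wk y) (App Succ (App Succ v0))) (three v0)).

Lemma term_roundR V (e : env S V) (y : tm V (Arr N N)) n :
  `|term (eval e (roundR y)) n - term (eval e y) (sc (sc n))| < epsilon (sc (sc (sc n))).
Proof.
rewrite /term eval_lam //.
have := val_roundQ (econs e n) (App (wk y) (App Succ (App Succ v0))) (three v0).
by cbn [eval three]; rewrite eval_wk.
Qed.

(** Bounds the values of any real that is close to [x] at the index zero: the
    numerators of [x 0] bound its absolute value, the closeness adds two, and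
    the variation of a real from its approximation at zero adds one. *)
Definition value_bound V (x : tm V (Arr N N)) : tm V N :=
  add (add (rpos (App x Zero)) (rneg (App x Zero))) (three Zero).

(** A numerator of the rounding at precision [k] is at most [2^k] times a bound
    on the values, and the pairing is monotone. *)
Definition code_bound V (x : tm V (Arr N N)) : tm V (Arr N N) :=
  lam (rat (mul (wk (value_bound x)) (pow2 (three v0))) (mul (wk (value_bound x)) (pow2 (three v0)))
    (predN (pow2 (three v0)))).

Section Bound.
Variables (V : vars) (e : env S V) (x y : tm V (Arr N N)).

Lemma app_code_bound n (k := sc (sc (sc n))) (B := eval e (value_bound x)) :
  app (eval e (code_bound x)) n =
  npair (npair (times B (pow k)) (times B (pow k))) (pre (pow k)).
Proof.
by rewrite eval_lam // eval_rat eval_predN !(eval_mul HS) !eval_wk eval_pow2.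
Qed.

Lemma value_bound_spec : is_real (term (eval e y)) ->
  near (term (eval e x)) (term (eval e y)) (zero S) ->
  forall n, `|term (eval e y) n| <= emb (eval e (value_bound x)).
Proof.
move=> Hy; rewrite /near epsilon0 => H0 n.
have := Hy (zero S) n; rewrite plus_0l // epsilon0.
have : `|term (eval e x) (zero S)| <= emb (eval e (value_bound x)) - 3.
  rewrite /value_bound 2!eval_add 2!emb_add eval_rpos eval_rneg; cbn [eval three].
  rewrite !emb_sc emb0 /term /val.
  set p := emb (nfst _); set m := emb (nsnd _); set d := emb (sc _).
  have p0 : 0 <= p by apply: emb_ge0.
  have m0 : 0 <= m by apply: emb_ge0.
  have d1 : 1 <= d by rewrite /d emb_sc; have := emb_ge0 (nsnd (app (eval e x) (zero S))); lra.
  rewrite normf_div (ger0_norm (x := d)); last lra.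
  rewrite ler_pdivrMr; last lra.
  have : `|p - m| <= p + m by rewrite ler_norml; apply/andP; split; lra.
  by nra.
move: H0; rewrite !ler_norml !ltr_norml => /andP[? ?] /andP[? ?] /andP[? ?].
by apply/andP; split; lra.
Qed.

Lemma roundR_le_code_bound : is_real (term (eval e y)) ->
  near (term (eval e x)) (term (eval e y)) (zero S) ->
  forall n, le (app (eval e (roundR y)) n) (app (eval e (code_bound x)) n).
Proof.
move=> Hy H0 n; rewrite app_code_bound eval_lam // eval_roundQ.
have := value_bound_spec Hy H0 (sc (sc n)); rewrite /term /val.
cbn [eval three]; rewrite eval_wk; cbn [eval econs v0].
set k := sc (sc (sc n)); set q := app _ _; set B := eval e _.
have le_floor_scaled p m d : emb (minus p m) / emb (sc d) <= emb B ->
    le (floor_scaled p m d k) (times B (pow k)).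
  move=> H; apply/emb_le; rewrite emb_mul -ler_pdivrMr ?pow_gt0 //.
  by have /andP[K _] := floor_scaled_bounds p m d k; apply: Order.POrderTheory.le_trans K H.
have max_le p m d : `|(emb p - emb m) / emb (sc d)| <= emb B ->
    emb (minus p m) / emb (sc d) <= emb B.
  have d0 := emb_sc_gt0 d; rewrite ler_norml ler_pdivrMr // => /andP[_ H].
  by rewrite emb_minus ler_pdivrMr // ge_max H /= mulr_ge0 ?(ltW d0) // emb_ge0.
move=> H; apply: pair_mono => //; last exact: ModelArithmetic.le_refl.
apply: pair_mono => //; apply/le_floor_scaled/max_le => //.
by rewrite -opprB mulNr normrN.
Qed.

Lemma code_bound_mono n i : le n i ->
  le (app (eval e (code_bound x)) n) (app (eval e (code_bound x)) i).
Proof.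
move=> H; rewrite !app_code_bound.
have K : le (pow (sc (sc (sc n)))) (pow (sc (sc (sc i)))).
  by apply: pow_mono => //; do 3 apply/(le_SS HS).
apply: pair_mono => //.
  by apply: pair_mono => //; apply: le_times2 => //; exact: ModelArithmetic.le_refl.
by apply/(le_SS HS); rewrite !pow_pred.
Qed.

End Bound.


(** * Standard objects *)

Lemma sat_EPAst V (e : env S V) A : EPAst A -> sat e A.
Proof. by move=> H; apply: (model_sat HS); apply: M_EPAst. Qed.

Lemma std_app s t (f : dom S (Arr s t)) a : std f -> std a -> std (app f a).
Proof. exact: (sat_EPAst (@params S) (@st_app_ax _ _ _ (Var f) (Var a))). Qed.

Lemma std_closed s (t : tm none s) : std (eval (@params S) (embed_closed t)).
Proof. exact: (sat_EPAst (@params S) (@st_closed_ax _ _ t)). Qed.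

Lemma std_eval V (e : env S V) s (t : tm V s) :
  (forall (r : ty) (x : V r), std (e r x)) -> std (eval e t).
Proof.
move=> He; elim: t => [r x|r q f IHf a IHa| | |r q|p r q|r] /=.
- exact: He.
- exact: std_app.
- exact: (std_closed Zero).
- exact: (std_closed Succ).
- exact: (std_closed Kc).
- exact: (std_closed Sc).
- exact: (std_closed Rec).
Qed.

Lemma std_sc n : std n -> std (sc n).
Proof. by move=> sn; apply: std_app => //; exact: (std_closed Succ). Qed.

Lemma std_zero : std (zero S).
Proof. exact: (std_closed Zero). Qed.

(** Majorization of sequences by a monotone sequence is pointwise. *)
Lemma std_bounded x y : (forall n, le (app x n) (app y n)) ->
  (forall n i, le n i -> le (app y n) (app y i)) -> std y -> std x.
Proof.
move=> xy yy sy.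
have M := sat_EPAst (@params S) (@st_maj_ax _ _ (Var x) (Var y)) sy.
apply: M; change (sat (@params S) (Maj (Var x) (Var y))).
apply/sat_All => v; apply/sat_All => u.
set e := econs _ u; move=> H.
have {}H : le u v by exact: (proj1 (sat_Le e v0 v1) H).
have Hx : le (app x u) (app y v) by apply: ModelArithmetic.le_trans (xy u) _ => //; apply: yy.
apply/sat_And; split.
  exact: (proj2 (sat_Le e (App (Var (vs (vs x))) v0) (App (Var (vs (vs y))) v1)) Hx).
exact: (proj2 (sat_Le e (App (Var (vs (vs y))) v0) (App (Var (vs (vs y))) v1)) (yy _ _ H)).
Qed.

Definition no_params : env S none := fun s v => match v with end.

Lemma std_econs V (e : env S V) s (d : dom S s) :
  (forall (r : ty) (v : V r), std (e r v)) -> std d ->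
  forall (r : ty) (v : ext V s r), std (econs e d v).
Proof. by move=> He sd r v; case: v. Qed.

Lemma std_no_params (r : ty) (v : none r) : std (no_params v).
Proof. by case: v. Qed.

(** Only the value of [t] matters, so that [code_bound] may be evaluated in an
    environment consisting of this standard value. *)
Lemma std_code_bound V (e : env S V) (t : tm V (Arr N N)) :
  std (eval e t) -> std (eval e (code_bound t)).
Proof.
move=> st; pose e' := econs no_params (eval e t).
suff -> : eval e (code_bound t) = eval e' (code_bound v0).
  by apply: std_eval; apply: std_econs => //; exact: std_no_params.
have EB : eval e (value_bound t) = eval e' (value_bound v0).
  by rewrite /value_bound 2!(eval_add e) 2!(eval_add e') !eval_rpos !eval_rneg.
apply: (@model_ext S HS N N) => n; have E := app_code_bound e' v0 n; rewrite -EB in E.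
exact: etrans (app_code_bound e t n) (esym E).
Qed.

(** The witness is the rounding of [y]: its codes are majorized by a sequence
    that is computed from [x] alone, hence standard. *)
Lemma std_real_near x y : std x -> is_real (term y) -> approx (term x) (term y) ->
  exists z, [/\ std z, is_real (term z) & forall n, `|term y n - term z n| < 3 / 2 * epsilon n].
Proof.
move=> sx Hy xy; pose e := econs (econs no_params x) y.
have R n := term_roundR e v0 n.
exists (eval e (roundR v0)); split; last exact: rounding_near.
  apply: (@std_bounded _ (eval e (code_bound v1))).
  - exact: (@roundR_le_code_bound _ e v1 v0 Hy (xy _ std_zero)).
  - exact: code_bound_mono.
  exact: std_code_bound.
exact: real_rounding R.
Qed.

(** * The two notions of openness *)

Section Sets.
Implicit Types U : dom S (Arr (Arr N N) N).

Definition in_set x U : Prop := is_real (term x) /\ app U x = sc (zero S).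
Definition set_of_reals U : Prop := forall x y, is_real (term x) -> is_real (term y) ->
  eqr (term x) (term y) -> app U x = app U y.
Definition much_less f g : Prop := ltr f g /\ ~ approx g f.
Definition open_st U : Prop := forall x, std x -> in_set x U ->
  exists2 r : seq, std r & [/\ is_real (term r), much_less zeror (term r) &
    forall y, std y -> is_real (term y) -> much_less (dist (term x) (term y)) (term r) ->
      in_set y U].
Definition open_ns U : Prop := forall x, std x -> in_set x U ->
  forall y, is_real (term y) -> approx (term x) (term y) -> in_set y U.

Lemma open_st_ns U : set_of_reals U -> open_st U -> open_ns U.
Proof.
move=> HU HO x sx Hx y Hy xy; split=> //.
have [r sr [Hr [r0 nr] HB]] := HO x sx Hx.
have [z [sz Hz yz]] := std_real_near sx Hy xy.
have [_ <-] : in_set z U.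
  apply: HB => //; apply: ltr_of_infinitesimal => // [|n sn|n]; [exact: std_sc| |exact: normr_ge0].
  move: (xy _ (std_sc sn)) (yz (sc n)); rewrite /near /dist (epsilon_sc n).
  have := epsilon_gt0 (sc n).
  rewrite ler_norml !ltr_norml => ? /andP[? ?] /andP[? ?]; apply/andP; split; lra.
apply: (HU y z) => // n; rewrite /near; have := yz n; have := epsilon_gt0 n; lra.
Qed.

(** The axiom of realization, read in the model, for witnesses that are numbers;
    majorization is then the order. *)
Lemma realization V (e : env S V) s (A : fm (ext (ext V s) N)) : internal A ->
  (forall d, exists2 n, std n & sat (econs (econs e d) n) A) ->
  exists2 z, std z & forall d, exists2 n, le n z & sat (econs (econs e d) n) A.
Proof.
move=> HA H.
have K : sat e (All s (ExSt N A)).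
  apply/sat_All => d; apply/sat_Ex; have [n sn Hn] := H d.
  by exists n; apply/sat_And.
have : sat e (ExMonSt N (All s (Ex N (And (Maj v0 (wk v1))
    (ren_fm (up_ren (up_ren (@vs V N))) A))))) := model_sat HS e (@R_ax _ _ _ _ HA) K.
move=> /sat_Ex[z /sat_And[sz /sat_And[_ /sat_All Hz]]].
exists z => // d; have /sat_Ex[n /sat_And[H1 H2]] := Hz d.
exists n; first exact: (proj1 (sat_Le _ v0 (wk v1)) H1).
move/sat_sub: H2; congr sat; apply: env_ext => r v.
by case: v => // r' v; case: v.
Qed.

(** Realization is applied to the assertion [A] that [y] is not a real, or is
    separated from [x] at the index [n], or is in [U]; a standard such [n] exists
    for every [y] by nonstandard openness. *)
Lemma open_ns_st U : set_of_reals U -> open_ns U -> open_st U.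
Proof.
move=> HU HO x sx Hx.
pose X : tm (ext (ext (dom S) (Arr N N)) N) (Arr N N) := Var (vs (vs x)).
pose A : fm (ext (ext (dom S) (Arr N N)) N) :=
  Imp (IsReal v1) (Imp (close X v1 v0) (InSet v1 (Var (vs (vs U))))).
have satA y n : sat (econs (econs (@params S) y) n) A <->
    (is_real (term y) -> near (term x) (term y) n -> in_set y U).
  set e := econs _ n; split=> [H Hy xy|H].
    have : sat e (InSet v1 (Var (vs (vs U)))) :=
      H (proj2 (sat_IsReal e v1) Hy) (proj2 (sat_close e X v1 v0) xy).
    by rewrite sat_And sat_IsReal.
  move=> /(proj1 (sat_IsReal e v1)) Hy /(proj1 (sat_close e X v1 v0)) xy.
  change (sat e (InSet v1 (Var (vs (vs U))))).
  by apply/sat_And; rewrite sat_IsReal; exact: H.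
have [z sz Hz] : exists2 z, std z & forall y, exists2 n, le n z &
    sat (econs (econs (@params S) y) n) A.
  apply: (@realization _ (@params S) (Arr N N) A) => [|y]; first by rewrite /A /=; tauto.
  (* Otherwise [y] is a real outside [U] that no standard index separates from [x]. *)
  apply: contrapT => K.
  have Kn n : std n -> is_real (term y) /\ near (term x) (term y) n /\ ~ in_set y U.
    by move=> sn; apply: contrapT => L; apply: K; exists n => //; apply/satA; tauto.
  have [Hy [_ nU]] := Kn _ std_zero.
  by apply: nU; apply: (HO x sx Hx y Hy) => n /Kn[_ []].
(* The radius is the constant [2^-(z+1)]. *)
pose r : seq := eval (econs no_params z) (lam (eps (App Succ (Var (vs vz))))).
have rE n : term r n = epsilon (sc z) by rewrite /term eval_lam // val_eps.
have sr : std r by apply: std_eval; apply: std_econs => //; exact: std_no_params.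
exists r => //; split.
- by move=> n i; rewrite !rE subrr normr0 epsilon_gt0.
- split.
    exists (sc (sc (sc z))); rewrite rE /zeror subr0.
    have := epsilon_gt0 (sc (sc (sc z))); rewrite (epsilon_sc (sc z)) (epsilon_sc (sc (sc z))); lra.
  move=> /(_ (sc (sc (sc z)))); rewrite /near rE /zeror subr0 gtr0_norm ?epsilon_gt0 //.
  have := epsilon_gt0 (sc (sc (sc z))); rewrite (epsilon_sc (sc z)) (epsilon_sc (sc (sc z))).
  move=> ? H; have := H (std_sc (std_sc (std_sc sz))); lra.
move=> y sy Hy [ydist _].
pose y' : seq := eval (econs no_params y) (lam (App (Var (vs vz)) (App Succ v0))).
have y'E : term y' = term y \o @sc S by apply/funext => n; rewrite /term eval_lam.
have Hy' : is_real (term y') by rewrite y'E; apply: real_shift.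
have [n [c nz] /satA Hn] := Hz y'; split=> //.
have [_ <-] : in_set y' U.
  apply: Hn => //; rewrite y'E; apply: near_shift ydist => //; first by case: Hx.
  by move=> m; rewrite rE -nz -plus_Sl // epsilon_plus.
by apply: (HU y y') => //; rewrite y'E; apply: eqr_shift.
Qed.

Section SatSets.
Variables (V : vars) (e : env S V) (U : tm V (Arr (Arr N N) N)).

Lemma sat_InSet (x : tm V (Arr N N)) : sat e (InSet x U) <-> in_set (eval e x) (eval e U).
Proof. by rewrite sat_And sat_IsReal. Qed.

Lemma sat_IsSet : sat e (IsSet U) -> set_of_reals (eval e U).
Proof.
move=> H x y Hx Hy xy; pose e' := econs (econs e x) y.
have K : sat e' (Imp (IsReal v1) (Imp (IsReal v0) (Imp (EqR v1 v0)
  (Eq (App (wk (wk U)) v1) (App (wk (wk U)) v0))))) := H x y.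
have : eval e' (App (wk (wk U)) v1) = eval e' (App (wk (wk U)) v0) :=
  K (proj2 (sat_IsReal e' v1) Hx) (proj2 (sat_IsReal e' v0) Hy) (proj2 (sat_EqR e' v1 v0) xy).
by rewrite 2!eval_app !eval_wk.
Qed.
End SatSets.

Section SatOpen.
Variables (V : vars) (e : env S V) (U : tm V (Arr (Arr N N) N)).

Let in1 x : sat (econs e x) (InSet v0 (wk U)) <-> in_set x (eval e U).
Proof. by rewrite sat_InSet eval_wk. Qed.

Let in2 x y : sat (econs (econs e x) y) (InSet v0 (wk (wk U))) <-> in_set y (eval e U).
Proof. by rewrite sat_InSet !eval_wk. Qed.

Let in3 x (r : seq) y :
  sat (econs (econs (econs e x) r) y) (InSet v0 (wk (wk (wk U)))) <-> in_set y (eval e U).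
Proof. by rewrite sat_InSet !eval_wk. Qed.

Lemma sat_OpenNs : sat e (OpenNs U) <-> open_ns (eval e U).
Proof.
split=> [/sat_AllSt H x sx Hx y Hy xy|H].
  apply/(in2 x); apply: (H x sx (proj2 (in1 x) Hx) y).
    exact: (proj2 (sat_IsReal (econs (econs e x) y) v0)).
  exact: (proj2 (sat_Approx (econs (econs e x) y) v1 v0)).
apply/sat_AllSt => x sx /in1 Hx y; set e' := econs _ y.
move=> /(proj1 (sat_IsReal e' v0)) Hy /(proj1 (sat_Approx e' v1 v0)) xy.
exact: (proj2 (in2 x y) (H x sx Hx y Hy xy)).
Qed.

Lemma sat_OpenSt : sat e (OpenSt U) <-> open_st (eval e U).
Proof.
have much x (r : seq) y : sat (econs (econs (econs e x) r) y) (LtLtR (distR (wk v1) v0) v1) <->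
    much_less (dist (term x) (term y)) (term r).
  by rewrite sat_LtLtR term_distR eval_wk.
have much0 x (r : seq) : sat (econs (econs e x) r) (LtLtR zeroR v0) <-> much_less zeror (term r).
  by rewrite sat_LtLtR term_zeroR.
pose A : fm (ext (ext V (Arr N N)) (Arr N N)) :=
  And (IsReal v0) (And (LtLtR zeroR v0) (AllSt (Arr N N)
    (Imp (IsReal v0) (Imp (LtLtR (distR (wk v1) v0) v1) (InSet v0 (wk (wk (wk U)))))))).
split=> [/sat_AllSt H x sx Hx|H].
  have : sat (econs e x) (ExSt (Arr N N) A) := H x sx (proj2 (in1 x) Hx).
  move=> /sat_Ex[r /sat_And[sr /sat_And[Hr /sat_And[r0 /sat_AllSt HB]]]].
  exists r => //; split; first exact: (proj1 (sat_IsReal (econs (econs e x) r) v0) Hr).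
    exact/(much0 x).
  move=> y sy Hy xy; pose e' := econs (econs (econs e x) r) y.
  apply: (proj1 (in3 x r y)); apply: (HB y sy); first exact: (proj2 (sat_IsReal e' v0) Hy).
  exact: (proj2 (much x r y) xy).
apply/sat_AllSt => x sx /in1 Hx; have [r sr [Hr r0 HB]] := H x sx Hx.
apply: (proj2 (sat_Ex (econs e x) (And (St v0) A))); exists r.
apply/sat_And; split=> //; apply/sat_And; split.
  exact: (proj2 (sat_IsReal (econs (econs e x) r) v0) Hr).
apply/sat_And; split; first exact/much0.
apply/sat_AllSt => y sy; set e' := econs _ y.
move=> /(proj1 (sat_IsReal e' v0)) Hy /(proj1 (much x r y)) xy.
exact: (proj2 (in3 x r y) (HB y sy Hy xy)).
Qed.
End SatOpen.
End Sets.

End Values.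

Theorem equivalence_in_model (e : env S none) :
  sat e (All (Arr (Arr N N) N) (Imp (IsSet v0) (Iff (OpenSt v0) (OpenNs v0)))).
Proof.
have [F [emb Hemb]] := embedding_exists.
apply/sat_All => U; set e' := econs e U => /(sat_IsSet Hemb) HU.
change (sat e' (Iff (OpenSt v0) (OpenNs v0))); apply/sat_Iff.
rewrite (sat_OpenSt Hemb) (sat_OpenNs Hemb).
by split; [exact: (open_st_ns Hemb)|exact: (open_ns_st Hemb)].
Qed.
End Model.
End OpenSets.

Require Import Defs.

Theorem theorem4p11 :
  M_proves (All ty2 (IsSet v0 ==> (OpenSt v0 <==> OpenNs v0)))%fm.
Proof.
  apply Completeness.completeness; intros S HS e.
  exact (@OpenSets.equivalence_in_model S HS e).
Qed.
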